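(* Fix $p\ge3$ and let $(\beta,h)\in\Theta$ be $p$-special, with $\beta$ known and $\bm X\sim\mathbb P_{\beta,h,p}$. Let $m_*$ be the unique global maximizer of $H=H_{\beta,h,p}$. For $a,b\in\mathbb R$ let $F_{a,b}$ be the probability distribution (and its distribution function) with Lebesgue density proportional to $\exp\big(\frac{H^{(4)}(m_* )}{24}x^4+(apm_*^{p-1}+b)x\big)$. Then as $N\to\infty$, $N^{3/4}(\hat h_N-h)\to G_1$ in distribution, where $G_1(t)=F_{0,0}\big(\int_{-\infty}^\infty u\,\mathrm dF_{0,t}(u)\big)$.
   Context: The $p$-tensor Curie–Weiss model on $\{-1,1\}^N$: $\mathbb P_{\beta,h,p}(\bm X)=\frac{1}{2^NZ_N(\beta,h,p)}\exp\{N(\beta\bar X_N^p+h\bar X_N)\}$ with $\bar X_N=N^{-1}\sum_iX_i$, $(\beta,h)\in\mathbb R^2$; $\Theta=[0,\infty)\times\mathbb R$. $I(x)=\frac12[(1+x)\log(1+x)+(1-x)\log(1-x)]$, $H_{\beta,h,p}(x)=\beta x^p+hx-I(x)$ on $[-1,1]$. $(\beta,h)$ is $p$-special if $H_{\beta,h,p}$ has a unique global maximizer $m_*\in(-1,1)$ and $H''(m_* )=0$. For known $\beta$, $\hat h_N$ is the maximum likelihood estimate of $h$, i.e. the solution in $h$ of $\mathbb E_{\beta,h,p}(\bar X_N)=\bar X_N$. *)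

(* Defs.v *)
From HB Require Import structures.
From mathcomp Require Import all_boot all_order all_algebra.
From mathcomp Require Import all_classical all_reals all_analysis.
Import Order.TTheory GRing.Theory Num.Theory.
Import numFieldNormedType.Exports.
Local Open Scope classical_set_scope.
Local Open Scope ring_scope.

Section CW.
Variable R : realType.

Definition Ient (x : R) : R :=
  2^-1 * ((1 + x) * ln (1 + x) + (1 - x) * ln (1 - x)).

Definition Hfun (p : nat) (beta h : R) (x : R) : R :=
  beta * x ^+ p + h * x - Ient x.

Definition global_maximizer (f : R -> R) (m : R) : Prop :=
  -1 <= m <= 1 /\ forall x : R, -1 <= x <= 1 -> f x <= f m.

Definition pspecial (p : nat) (beta h : R) : Prop :=
  exists m : R, [/\ -1 < m < 1, global_maximizer (Hfun p beta h) m,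
    (forall m', global_maximizer (Hfun p beta h) m' -> m' = m)
    & derive1n 2 (Hfun p beta h) m = 0].

(* configurations X in {-1,1}^N, encoded by x : 'I_N -> bool (true = +1) *)
Definition spin (b : bool) : R := if b then 1 else -1.

Definition Xbar (N : nat) (x : {ffun 'I_N -> bool}) : R :=
  (N%:R)^-1 * \sum_(i < N) spin (x i).
Arguments Xbar {N} x.

Definition ZN (p N : nat) (beta h : R) : R :=
  (2 ^+ N)^-1 *
  \sum_(x : {ffun 'I_N -> bool}) expR (N%:R * (beta * Xbar x ^+ p + h * Xbar x)).

Definition Pcw (p N : nat) (beta h : R) (x : {ffun 'I_N -> bool}) : R :=
  expR (N%:R * (beta * Xbar x ^+ p + h * Xbar x)) / (2 ^+ N * ZN p N beta h).

Definition ProbCW (p N : nat) (beta h : R) (A : pred {ffun 'I_N -> bool}) : R :=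
  \sum_(x : {ffun 'I_N -> bool} | A x) Pcw p N beta h x.

Definition EXbar (p N : nat) (beta h : R) : R :=
  \sum_(x : {ffun 'I_N -> bool}) Xbar x * Pcw p N beta h x.

(* MLE of h (beta known): a solution h' of E_{beta,h',p}(Xbar_N) = Xbar_N;
   conventionally 0 if no solution exists (only when Xbar_N = +-1). *)
Definition hhat (p N : nat) (beta : R) (x : {ffun 'I_N -> bool}) : R :=
  xget 0 [set h' : R | EXbar p N beta h' = Xbar x].

Definition phiF (p : nat) (beta h m a b : R) (x : R) : R :=
  derive1n 4 (Hfun p beta h) m / 24%:R * x ^+ 4
  + (a * p%:R * m ^+ p.-1 + b) * x.

Definition Fab (p : nat) (beta h m a b : R) (t : R) : R :=
  Rintegral lebesgue_measure `]-oo, t] (fun x => expR (phiF p beta h m a b x))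
  / Rintegral lebesgue_measure setT (fun x => expR (phiF p beta h m a b x)).

Definition meanF (p : nat) (beta h m a b : R) : R :=
  Rintegral lebesgue_measure setT (fun x => x * expR (phiF p beta h m a b x))
  / Rintegral lebesgue_measure setT (fun x => expR (phiF p beta h m a b x)).

Definition G1 (p : nat) (beta h m : R) (t : R) : R :=
  Fab p beta h m 0 0 (meanF p beta h m 0 t).

End CW.

Arguments Ient {R}.
Arguments Hfun {R}.
Arguments global_maximizer {R}.
Arguments pspecial {R}.
Arguments spin {R}.
Arguments ZN {R}.
Arguments EXbar {R}.
Arguments phiF {R}.
Arguments Fab {R}.
Arguments meanF {R}.
Arguments G1 {R}.
Arguments Xbar {R} {N} x.
Arguments Pcw {R} p N beta h x.
Arguments ProbCW {R} p N beta h A.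
Arguments hhat {R} p N beta x.

(* Main.v *)
Require Import Defs.
From HB Require Import structures.
From mathcomp Require Import all_boot all_order all_algebra.
From mathcomp Require Import all_classical all_reals all_analysis.
From mathcomp Require Import measurable_realfun.
From mathcomp Require Import ring lra zify.
Set Implicit Arguments.
Unset Strict Implicit.
Unset Printing Implicit Defensive.
Import Order.TTheory GRing.Theory Num.Theory.
Import numFieldNormedType.Exports.
Local Open Scope classical_set_scope.
Local Open Scope ring_scope.

(** The mean magnetization is strictly increasing in the field, so for
    [-1 < Xbar < 1] the event [N^(3/4) (hhat - h) <= t] is
    [Xbar <= EXbar (h + t N^(-3/4))].  At a special point the first three
    derivatives of [H] vanish at [m] and the fourth one, [k = - 4 / (1 - m^2)^3],
    is negative, so the weight of [Xbar = m + y N^(-1/4)], relative to that of [m],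
    tends to [exp (k y^4 / 24)], and tilting [h] by [t N^(-3/4)] multiplies it by
    [exp (t y)] up to a constant.  Sums over the lattice of values of [y] (mesh
    [2 N^(-3/4)]) are integrals of step functions, so dominated convergence gives
    both the limit [s] of [N^(1/4) (EXbar (h + t N^(-3/4)) - m)] and that of the
    probability that [N^(1/4) (Xbar - m) <= s].  Stirling's formula is not needed:
    only the increments of [n - n ln n + ln n!] matter, and they lie in
    [[0, 1 / (n + 1)]]. *)

(** * Binomial coefficients *)

(** The error [ln n! - (n ln n - n)] of Stirling's approximation, which grows like half the
    logarithm of [2 pi n]. *)
Definition stirling_rem {R : realType} (n : nat) : R :=
  n%:R - n%:R * ln n%:R + ln (n`!%:R).

Section stirling.
Variable R : realType.
Local Notation r := (@stirling_rem R).

Lemma stirling_rem0 : r 0 = 0.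
Proof. by rewrite /stirling_rem fact0 ln1 mul0r subr0 addr0. Qed.

Lemma stirling_remS n :
  r n.+1 - r n = 1 - n%:R * (ln n.+1%:R - ln n%:R).
Proof.
rewrite /stirling_rem factS natrM lnM ?posrE ?ltr0n ?fact_gt0//.
rewrite -natr1; ring.
Qed.

(** For [n > 0] both bounds are instances of [ln (1 + x) <= x], at [x = 1 / n] and at
    [x = - 1 / (n + 1)]. *)
Lemma stirling_rem_step n : 0 <= r n.+1 - r n <= n.+1%:R^-1.
Proof.
rewrite stirling_remS; case: n => [|n].
  by rewrite mul0r subr0 ler01 invr1 lexx.
have n0 : 0 < n.+1%:R :> R by rewrite ltr0n.
have n1 : 0 < n.+2%:R :> R by rewrite ltr0n.
have e2 : n.+2%:R = n.+1%:R + 1 :> R by rewrite natr1.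
apply/andP; split.
- have : ln (1 + n.+1%:R^-1) <= n.+1%:R^-1 :> R.
    by apply: le_ln1Dx; rewrite (lt_trans _ (_ : 0 < _)) ?invr_gt0 ?ltrN10.
  have -> : 1 + n.+1%:R^-1 = n.+2%:R / n.+1%:R :> R.
    by rewrite e2 mulrDl mul1r divff ?gt_eqF.
  rewrite ln_div ?posrE// => /(ler_wpM2l (ltW n0)).
  by rewrite divff ?gt_eqF// subr_ge0.
- have : ln (1 + (- n.+2%:R^-1)) <= - n.+2%:R^-1 :> R.
    by apply: le_ln1Dx; rewrite ltrN2 invf_lt1// ltr1n.
  have -> : 1 + (- n.+2%:R^-1) = n.+1%:R / n.+2%:R :> R.
    by apply: (mulIf (lt0r_neq0 n1)); rewrite mulrBl mul1r mulVf ?divfK ?lt0r_neq0// e2 addrK.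
  rewrite ln_div ?posrE// => /(ler_wpM2l (ltW n0)) H.
  have : n.+1%:R * n.+2%:R^-1 = 1 - n.+2%:R^-1 :> R.
    by apply: (mulIf (lt0r_neq0 n1)); rewrite mulrBl mul1r mulVf ?divfK ?lt0r_neq0// e2 addrK.
  by move: H; set A := ln _; set B := ln _; set C := _^-1; set n1' := n.+1%:R; lra.
Qed.

Lemma stirling_rem_nd m n : (m <= n)%N -> r m <= r n.
Proof.
elim: n => [|n IH]; first by rewrite leqn0 => /eqP ->.
rewrite leq_eqVlt => /orP[/eqP ->//|]; rewrite ltnS => /IH h.
by have /andP[] := stirling_rem_step n; lra.
Qed.

Lemma stirling_rem_lip (d : R) m n : 0 < d -> d <= m.+1%:R -> (m <= n)%N ->
  r n - r m <= (n%:R - m%:R) / d.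
Proof.
move=> d0 dm; elim: n => [|n IH].
  by rewrite leqn0 => /eqP ->; rewrite !subrr mul0r.
rewrite leq_eqVlt => /orP[/eqP ->|]; first by rewrite !subrr mul0r.
rewrite ltnS => mn; have /andP[_] := stirling_rem_step n.
have : n.+1%:R^-1 <= d^-1 :> R.
  by rewrite lef_pV2 ?posrE ?ltr0n// (le_trans dm)// ler_nat ltnS.
by have := IH mn; rewrite -(natr1 n) !mulrBl mulrDl mul1r; lra.
Qed.

Lemma stirling_rem_dist (d : R) m n : 0 < d -> d <= m.+1%:R -> d <= n.+1%:R ->
  `|r n - r m| <= `|n%:R - m%:R| / d.
Proof.
move=> d0; wlog mn : m n / (m <= n)%N => [H|dm _].
  move=> dm dn; have [/H|/ltnW/H] := leqP m n; first exact.
  by rewrite distrC (distrC m%:R); exact.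
rewrite !ger0_norm ?subr_ge0 ?ler_nat ?stirling_rem_nd//.
exact: stirling_rem_lip.
Qed.

(** Increments are at most [1] up to [K] and at most [1 / K] beyond it. With [K] large and fixed,
    this makes the remainder negligible against an exponent that is linear in [n]. *)
Lemma stirling_rem_sublinear (K n : nat) : (0 < K)%N -> r n <= K%:R + n%:R / K%:R.
Proof.
move=> K0; have K0' : 0 < K%:R :> R by rewrite ltr0n.
have [nK|/ltnW Kn] := leqP n K.
  have := @stirling_rem_lip 1 0 n ltr01 (lexx _) (leq0n _).
  rewrite stirling_rem0 !subr0 divr1.
  have : n%:R <= K%:R :> R by rewrite ler_nat.
  have : 0 <= n%:R / K%:R :> R by rewrite divr_ge0.
  lra.
have := @stirling_rem_lip 1 0 K ltr01 (lexx _) (leq0n _).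
rewrite stirling_rem0 !subr0 divr1.
have KS : K%:R <= K.+1%:R :> R by rewrite ler_nat.
have := @stirling_rem_lip K%:R K n K0' KS Kn.
have : 0 < K%:R / K%:R :> R by rewrite divff ?gt_eqF.
by rewrite mulrBl; lra.
Qed.

(* Also valid at [k = 0] and [k = N], because [ln 0 = 0] in the library. *)
Lemma ln_bin_stirling (N k : nat) : (0 < N)%N -> (k <= N)%N ->
  'C(N, k)%:R = 2 ^+ N * expR (r N - r k - r (N - k) - N%:R * Ient (2 * k%:R / N%:R - 1)) :> R.
Proof.
move=> N0 kN; have N0' : 0 < N%:R :> R by rewrite ltr0n.
have two0 : 0 < 2 :> R by [].
have eN : (N - k)%:R = N%:R - k%:R :> R by rewrite natrB.
have C0 : 0 < 'C(N, k)%:R :> R by rewrite ltr0n bin_gt0.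
have lnF : ln N`!%:R = ln 'C(N, k)%:R + (ln k`!%:R + ln (N - k)`!%:R) :> R.
  by rewrite -(bin_fact kN) !natrM !lnM ?posrE ?mulr_gt0 ?ltr0n ?bin_gt0 ?fact_gt0.
have lnk (j : nat) : j%:R * ln (2 * j%:R / N%:R) = j%:R * (ln 2 + ln j%:R - ln N%:R) :> R.
  case: j => [|j]; first by rewrite !mul0r.
  by rewrite ln_div ?lnM ?posrE ?mulr_gt0 ?ltr0n.
have Ie : N%:R * Ient (2 * k%:R / N%:R - 1) =
    k%:R * ln (2 * k%:R / N%:R) + (N - k)%:R * ln (2 * (N - k)%:R / N%:R) :> R.
  rewrite /Ient; have -> : 1 + (2 * k%:R / N%:R - 1) = 2 * k%:R / N%:R :> R by ring.
  have -> : 1 - (2 * k%:R / N%:R - 1) = 2 * (N - k)%:R / N%:R :> R.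
    by rewrite eN; field; rewrite gt_eqF.
  by field; rewrite gt_eqF.
rewrite Ie !lnk -[LHS]lnK ?posrE// -[2 ^+ N]lnK ?posrE ?exprn_gt0// -expRD lnXn//.
congr expR; rewrite /stirling_rem lnF eN -mulr_natl.
ring.
Qed.
End stirling.

(** * Local expansions *)

Section calculus.
Variable R : realType.
Implicit Types (f df : R -> R) (m c d e : R) (n : nat).

(** Taylor's expansion with Peano remainder when the terms of orders [1] to [n - 1] vanish. *)
Definition monomial_expansion n f m c :=
  forall e, 0 < e -> exists2 d : R, 0 < d &
    forall x, `|x - m| < d -> `|f x - f m - c * (x - m) ^+ n| <= e * `|x - m| ^+ n.

(** Mean value theorem between [m] and [x]: the intermediate point is no farther from [m] than [x],
    so the bound on [f'] at distance [|x - m|] applies to it. *)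
Lemma mvt_monomial f (f' : R -> R) m d e n :
  (forall x, `|x - m| < d -> is_derive x 1 f (f' x)) -> f m = 0 ->
  (forall x, `|x - m| < d -> `|f' x| <= e * `|x - m| ^+ n) ->
  forall x, `|x - m| < d -> `|f x| <= e * `|x - m| ^+ n.+1.
Proof.
move=> df fm f'e x xd.
have aux a b : a <= b -> (forall y, a <= y <= b -> `|y - m| <= `|x - m|) ->
    `|f b - f a| <= e * `|x - m| ^+ n * (b - a).
  move=> ab near.
  have seg y : y \in `[a, b] -> `|y - m| < d.
    by rewrite in_itv/= => /near h; exact: le_lt_trans xd.
  have [||c cab ->] := @MVT_segment R f f' a b ab.
  - by move=> y /subset_itv_oo_cc /seg; exact: df.
  - apply: derivable_within_continuous => y /seg yd.
    by have [] := df y yd.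
  have cm : `|c - m| <= `|x - m| by apply: near; move: cab; rewrite in_itv.
  rewrite normrM (@ger0_norm _ (b - a)) ?subr_ge0// ler_wpM2r ?subr_ge0//.
  apply: (le_trans (f'e c (seg c cab))).
  (* For [e < 0] the inequality is immediate when [n = 0] or [x = m], and otherwise the bound on
     [f'] at [x] is contradictory. *)
  have [e0|e0] := leP 0 e; first by apply: ler_wpM2l => //; rewrite lerXn2r ?nnegrE.
  have := f'e x xd.
  have [->|n0] := eqVneq n 0; first by rewrite !expr0.
  have [->|xm] := eqVneq x m; first by rewrite subrr normr0 expr0n (negPf n0) mulr0 => _;
    rewrite nmulr_rle0 ?exprn_ge0.
  have : 0 < `|x - m| ^+ n by rewrite exprn_gt0// normr_gt0 subr_eq0.
  move=> p0 /(le_trans (normr_ge0 _)); by rewrite nmulr_rge0// leNgt p0.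
rewrite exprSr mulrA; have [mx|xm] := leP m x.
  have := aux m x mx; rewrite fm subr0 (@ger0_norm _ (x - m)) ?subr_ge0//; apply => y /andP[my yx].
  by rewrite !ger0_norm ?subr_ge0// lerB.
have := aux x m (ltW xm); rewrite fm sub0r normrN => h.
have e1 : `|x - m| = m - x by rewrite distrC gtr0_norm ?subr_gt0.
move: h; rewrite e1; apply => y /andP[xy ym].
by rewrite distrC ger0_norm ?subr_ge0// lerB.
Qed.

Lemma monomial_expansion1 f m c : is_derive m 1 f c -> monomial_expansion 1 f m c.
Proof.
move=> [df dfE] e e0.
have : (fun h => h^-1 *: ((f \o shift m) (h *: 1) - f m)) @ 0^' --> c.
  by rewrite -dfE; exact: df.
move=> /cvgrPdist_le /(_ e e0).
rewrite near_withinE near_simpl => /nbhs_ballP[d d0 H].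
exists d => // x xd; have [->|xm] := eqVneq x m.
  by rewrite !subrr !expr1 mulr0 subr0 normr0 mulr0.
have xm0 : x - m != 0 by rewrite subr_eq0.
have := H (x - m); rewrite /ball/= sub0r normrN => /(_ xd xm0).
rewrite /= [_%:A]mulr1 subrK !expr1 => h.
have -> : f x - f m - c * (x - m) = - (c - (x - m)^-1 * (f x - f m)) * (x - m).
  by field.
by rewrite normrM normrN ler_wpM2r.
Qed.

Lemma is_derive1X f n (x df : R) : is_derive x 1 f df ->
  is_derive x 1 (fun y => f y ^+ n) (n%:R * f x ^+ n.-1 * df).
Proof.
move=> /(@is_deriveX _ _ _ n); rewrite (_ : f ^+ n = fun y => f y ^+ n)//.
by apply/funext => y; rewrite exprfctE.
Qed.

(** Integrates an expansion of the derivative: the error [g] of the new expansion has as derivative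
    the error [g'] of the old one, and [mvt_monomial] raises its order by one. *)
Lemma monomial_expansionS n f (f' : R -> R) m c d : 0 < d ->
  (forall x, `|x - m| < d -> is_derive x 1 f (f' x)) -> f' m = 0 ->
  monomial_expansion n f' m c -> monomial_expansion n.+1 f m (c / n.+1%:R).
Proof.
move=> d0 df f'm H e e0; have [d1 d10 {}H] := H e e0.
exists (Num.min d d1) => [|x]; first by rewrite lt_min d0.
pose g x := f x - f m - c / n.+1%:R * (x - m) ^+ n.+1.
pose g' x := f' x - c * (x - m) ^+ n.
have n0 : n.+1%:R != 0 :> R by rewrite pnatr_eq0.
apply: (@mvt_monomial g g' m (Num.min d d1)) => [y||y].
- rewrite lt_min => /andP[yd _]; have dfy := df y yd.
  have dX := @is_derive1X (fun y => y - m) n.+1 y _ (is_deriveB (is_derive_id _ _) (is_derive_cst m _ _)).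
  have dZ := is_deriveZ (c / n.+1%:R) dX.
  apply: (is_derive_eq (is_deriveB (is_deriveB dfy (is_derive_cst (f m) y 1)) dZ)).
  rewrite /g' /= !subr0 mulr1 /GRing.scale/=; field.
  by rewrite addrC natr1.
- by rewrite /g !subrr expr0n/= mulr0 subrr.
- rewrite lt_min => /andP[_ /H]; by rewrite f'm subr0.
Qed.

(** An odd power keeps the sign, so a small step from [m] in the direction of the sign of [c] would
    raise [f] by at least half of [|c| s^n]. *)
Lemma monomial_expansion_odd_max f m c d n : 0 < d -> odd n ->
  (forall x, `|x - m| < d -> f x <= f m) -> monomial_expansion n f m c -> c = 0.
Proof.
move=> d0 on fmax H; apply/eqP/negPn/negP => c0.
have c0' : 0 < `|c| by rewrite normr_gt0.
have [d1 d10 {}H] := H (`|c| / 2) (divr_gt0 c0' (@ltr0Sn R 1)).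
pose s := Num.min d d1 / 2.
have m0 : 0 < Num.min d d1 by rewrite lt_min d0.
have s0 : 0 < s by rewrite divr_gt0.
have sm : s < Num.min d d1 by rewrite ltr_pdivrMr// ltr_pMr// ltr1n.
have sn0 : 0 < s ^+ n by rewrite exprn_gt0.
pose x := m + Num.sg c * s.
have xm : x - m = Num.sg c * s by rewrite /x addrC addKr.
have nx : `|x - m| = s by rewrite xm normrM normr_sg c0 mul1r gtr0_norm.
have := H x; have := fmax x; rewrite nx.
move: sm; rewrite lt_min => /andP[-> ->] /(_ isT) h1 /(_ isT).
have -> : c * (x - m) ^+ n = `|c| * s ^+ n.
  rewrite xm exprMn mulrA; congr (_ * _).
  have -> : Num.sg c ^+ n = Num.sg c.
    by rewrite -(odd_double_half n) on exprD expr1 -mul2n exprM sqr_sg c0 expr1n mulr1.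
  by rewrite mulrC -normrEsg.
have : 0 < `|c| * s ^+ n by rewrite mulr_gt0.
rewrite mulrAC ler_norml => h2 /andP[h3 _]; lra.
Qed.

(** Gives continuity of [Ient] up to the endpoints [-1] and [1], where one of its terms is
    [0 * ln 0 = 0]. *)
Lemma continuous_xlnx : continuous (fun u : R => u * ln u).
Proof.
have le_near (v z : R) : v < z -> \forall y \near v, y <= z.
  by move=> vz; exact: (@cvgr_le R R (nbhs v) _ id v (@cvg_id _ _) z vz).
move=> u; have [u0|u0|->] := ltgtP u 0.
- have : (fun=> 0) @ u --> (0 : R) by exact: cvg_cst.
  rewrite /continuous_at ln0 ?ltW// mulr0; apply: cvg_trans; apply: near_eq_cvg.
  near=> y; rewrite ln0 ?mulr0//; near: y; exact: le_near.
- apply: (@continuousM _ _ (@idfun R) (@ln R)); first exact: cvg_id.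
  exact: continuous_ln.
rewrite /continuous_at mul0r; apply/cvgrPdist_le => /= e e0.
near=> y; rewrite sub0r normrN.
have [y0|y0] := leP y 0; first by rewrite ln0// mulr0 normr0 ltW.
(* With [y = s^2] one has [y ln y = 2 s (s ln s)], and [- ln s < 1 / s] bounds its absolute value by
   [2 s]. *)
pose s := Num.sqrt y; have s0 : 0 < s by rewrite sqrtr_gt0.
have ys : y = s ^+ 2 by rewrite sqr_sqrtr// ltW.
have y1 : y <= 1 by near: y; apply: le_near; exact: ltr01.
have ye : y <= (e / 2) ^+ 2 by near: y; apply: le_near; rewrite exprn_gt0// divr_gt0.
have se : s <= e / 2.
  by rewrite -(@ler_pXn2r _ 2)// ?nnegrE -?ys// ltW// divr_gt0.
have : ln (s^-1) < s^-1 by apply: ln_sublinear; rewrite invr_gt0.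
rewrite lnV ?posrE// => h.
rewrite ler0_norm; last by rewrite pmulr_rle0// ln_le0.
rewrite ys lnXn// -mulr_natl.
have : s * (- ln s) <= 1.
  by rewrite -(@divff _ s) ?gt_eqF//; apply: ler_wpM2l (ltW h); exact: ltW.
move=> /(ler_wpM2l (ltW s0)).
by rewrite mulr1 expr2; lra.
Unshelve. all: by end_near. Qed.

End calculus.

(** * The Hamiltonian at a special point *)

Section Hamiltonian.
Variables (R : realType) (p : nat) (beta h : R).
Implicit Types (x m c d e : R) (n : nat).
Local Notation H := (Hfun p beta h).

(** [dH1] to [dH4] are closed forms of the successive derivatives of [H] on the open interval. A
    predecessor truncated at [0] does no harm, since a zero coefficient then multiplies the
    power. *)
Definition dH1 x : R :=
  beta * (p%:R * x ^+ p.-1) + h - 2^-1 * (ln (1 + x) - ln (1 - x)).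
Definition dH2 x : R :=
  beta * (p%:R * (p.-1%:R * x ^+ p.-2)) - (1 - x ^+ 2)^-1.
Definition dH3 x : R :=
  beta * (p%:R * (p.-1%:R * (p.-2%:R * x ^+ p.-2.-1))) - 2 * x * (1 - x ^+ 2) ^- 2.
Definition dH4 x : R :=
  beta * (p%:R * (p.-1%:R * (p.-2%:R * (p.-2.-1%:R * x ^+ p.-2.-2))))
  - (2 + 6 * x ^+ 2) * (1 - x ^+ 2) ^- 3.

Let is_derive_mono n x : is_derive x 1 (fun y : R => y ^+ n) (n%:R * x ^+ n.-1).
Proof. by apply: (is_derive_eq (is_derive1X n (is_derive_id x (1 : R)))); rewrite mulr1. Qed.

Let is_derive_shiftp x : is_derive x 1 (fun y : R => 1 + y) 1.
Proof.
have d1 := is_deriveD (is_derive_cst (1 : R) x (1 : R)) (is_derive_id x (1 : R)).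
by apply: (is_derive_eq d1); rewrite add0r.
Qed.

Let is_derive_shiftm x : is_derive x 1 (fun y : R => 1 - y) (-1).
Proof.
have d1 := is_deriveB (is_derive_cst (1 : R) x (1 : R)) (is_derive_id x (1 : R)).
by apply: (is_derive_eq d1); rewrite sub0r.
Qed.

Let is_derive_lnp x : -1 < x -> is_derive x 1 (fun y : R => ln (1 + y)) (1 + x)^-1.
Proof.
move=> x1; have p0 : 0 < 1 + x by lra.
by apply: (is_derive_eq (is_derive1_comp (is_derive1_ln p0) (is_derive_shiftp x))); rewrite mulr1.
Qed.

Let is_derive_lnm x : x < 1 -> is_derive x 1 (fun y : R => ln (1 - y)) (- (1 - x)^-1).
Proof.
move=> x1; have p0 : 0 < 1 - x by lra.
have dc := @is_derive1_comp R (@ln R) (fun y => 1 - y) x _ _ (is_derive1_ln p0) (is_derive_shiftm x).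
by apply: (is_derive_eq dc); rewrite mulrN1.
Qed.

Let is_derive_invsq x : -1 < x < 1 ->
  is_derive x 1 (fun y : R => (1 - y ^+ 2)^-1) (2 * x * (1 - x ^+ 2) ^- 2).
Proof.
move=> x1; have p0 : 1 - x ^+ 2 != 0 by rewrite gt_eqF//; nra.
have d0 : is_derive x 1 (fun y : R => 1 - y ^+ 2) (0 - (2%:R * x ^+ 2.-1)).
  exact: (is_deriveB (is_derive_cst (1 : R) x (1 : R)) (is_derive_mono 2 x)).
apply: (is_derive_eq (is_deriveV _ d0)) => //.
by rewrite /GRing.scale/= expr1 sub0r mulrN mulNr opprK mulrC.
Qed.

Lemma is_derive_Hfun x : -1 < x < 1 -> is_derive x 1 H (dH1 x).
Proof.
move=> /andP[x1 x2].
have dI : is_derive x 1 Ient (2^-1 * (ln (1 + x) - ln (1 - x))).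
  have dp := is_deriveM (is_derive_shiftp x) (is_derive_lnp x1).
  have dm := is_deriveM (is_derive_shiftm x) (is_derive_lnm x2).
  apply: (is_derive_eq (is_deriveZ 2^-1 (is_deriveD dp dm))).
  rewrite /GRing.scale/= !mulr1; field.
  by apply/andP; split; rewrite gt_eqF//; lra.
have dX := is_deriveZ beta (is_derive_mono p x).
have dh := is_deriveZ h (is_derive_id x (1 : R)).
apply: (is_derive_eq (is_deriveB (is_deriveD dX dh) dI)).
by rewrite /GRing.scale/= mulr1.
Qed.

Lemma is_derive_dH1 x : -1 < x < 1 -> is_derive x 1 dH1 (dH2 x).
Proof.
move=> x12; have /andP[x1 x2] := x12.
have dX := is_deriveZ beta (is_deriveZ p%:R (is_derive_mono p.-1 x)).
have dL := is_deriveZ 2^-1 (is_deriveB (is_derive_lnp x1) (is_derive_lnm x2)).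
apply: (is_derive_eq (is_deriveB (is_deriveD dX (is_derive_cst h x (1 : R))) dL)).
rewrite /GRing.scale/= /dH2 addr0; congr (_ - _); field.
by apply/and3P; split; rewrite gt_eqF//; nra.
Qed.

Lemma is_derive_dH2 x : -1 < x < 1 -> is_derive x 1 dH2 (dH3 x).
Proof.
move=> x12.
have dX := is_deriveZ beta (is_deriveZ p%:R (is_deriveZ p.-1%:R (is_derive_mono p.-2 x))).
exact: (is_derive_eq (is_deriveB dX (is_derive_invsq x12))).
Qed.

Lemma is_derive_dH3 x : -1 < x < 1 -> is_derive x 1 dH3 (dH4 x).
Proof.
move=> x12; have p0 : 1 - x ^+ 2 != 0 by rewrite gt_eqF//; nra.
have dX := is_deriveZ beta (is_deriveZ p%:R (is_deriveZ p.-1%:R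
  (is_deriveZ p.-2%:R (is_derive_mono p.-2.-1 x)))).
have dV := is_derive1X 2 (is_derive_invsq x12).
have d2 := is_deriveZ 2 (is_derive_id x (1 : R)).
have -> : dH3 = fun x => beta * (p%:R * (p.-1%:R * (p.-2%:R * x ^+ p.-2.-1)))
    - 2 * x * (1 - x ^+ 2)^-1 ^+ 2.
  by apply/funext => y; rewrite /dH3 exprVn.
apply: (is_derive_eq (is_deriveB dX (is_deriveM d2 dV))).
rewrite /dH4; congr (_ - _).
rewrite /= /GRing.scale/=; field.
exact: p0.
Qed.

Lemma derive1nS_itv (f g g' : R -> R) n :
  (forall x, -1 < x < 1 -> derive1n n f x = g x) ->
  (forall x, -1 < x < 1 -> is_derive x 1 g (g' x)) ->
  forall x, -1 < x < 1 -> derive1n n.+1 f x = g' x.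
Proof.
move=> fg gg' x x12; rewrite derive1nS derive1E.
rewrite (@near_eq_derive _ _ _ _ g).
  by have [_ ->] := gg' x x12.
have xi : x \in `]-1, 1[ by rewrite in_itv.
near=> y; apply: fg.
have : y \in `]-1, 1[ by near: y; exact: near_in_itvoo.
by rewrite in_itv.
Unshelve. all: by end_near. Qed.

Lemma derive1n2_Hfun x : -1 < x < 1 -> derive1n 2 H x = dH2 x.
Proof.
apply: (derive1nS_itv _ is_derive_dH1).
exact: (derive1nS_itv (n := 0) _ is_derive_Hfun).
Qed.

Lemma derive1n4_Hfun x : -1 < x < 1 -> derive1n 4 H x = dH4 x.
Proof.
apply: (derive1nS_itv _ is_derive_dH3).
apply: (derive1nS_itv _ is_derive_dH2).
exact: derive1n2_Hfun.
Qed.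

(** Eliminates [beta]: with [s = 1 - m^2], the quotient of the equations [dH3 m = 0] and [dH2 m = 0]
    gives [(p - 2) s = 2 m^2], hence [(p - 3) s = 3 m^2 - 1]. The power term of [dH4 m] is then
    [2 (3 m^2 - 1) / s^3]. *)
Lemma dH4_critical m : (3 <= p)%N -> -1 < m < 1 -> dH2 m = 0 -> dH3 m = 0 ->
  dH4 m = - 4 / (1 - m ^+ 2) ^+ 3.
Proof.
move=> p3 m12; have q0 : 0 < 1 - m ^+ 2 by nra.
have q0' := lt0r_neq0 q0.
set q := p.-2.-1.
have E : p = q.+3 by rewrite /q; lia.
rewrite /dH2 /dH3 /dH4 -/q E /=.
set A := beta * (q.+3%:R * q.+2%:R).
set s := 1 - m ^+ 2 in q0 q0' *.
have -> : beta * (q.+3%:R * (q.+2%:R * m ^+ q.+1)) = A * m ^+ q.+1 by rewrite /A !mulrA.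
have -> : beta * (q.+3%:R * (q.+2%:R * (q.+1%:R * m ^+ q))) = A * q.+1%:R * m ^+ q.
  by rewrite /A !mulrA.
have -> : beta * (q.+3%:R * (q.+2%:R * (q.+1%:R * (q%:R * m ^+ q.-1)))) =
    A * q.+1%:R * (q%:R * m ^+ q.-1) by rewrite /A !mulrA.
move=> /eqP; rewrite subr_eq0 => /eqP E2 /eqP; rewrite subr_eq0 => /eqP E3.
have m0 : m != 0.
  apply/eqP => m0; move: E2; rewrite m0 exprS mul0r mulr0 => /esym/eqP.
  by rewrite invr_eq0 (negPf q0').
have qs : q.+1%:R * s = 2 * m ^+ 2.
  apply: (mulIf (invr_neq0 (expf_neq0 2 q0'))).
  transitivity (m * (A * q.+1%:R * m ^+ q)); last by rewrite E3; ring.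
  have -> : m * (A * q.+1%:R * m ^+ q) = q.+1%:R * (A * m ^+ q.+1) by rewrite exprS; ring.
  by rewrite E2; field.
have qs' : q%:R * s = 3 * m ^+ 2 - 1.
  by move: qs; rewrite -natr1 mulrDl mul1r /s; lra.
have -> : A * q.+1%:R * (q%:R * m ^+ q.-1) = 2 * (q%:R * s) * s ^- 3.
  apply: (mulfI m0).
  have -> : m * (A * q.+1%:R * (q%:R * m ^+ q.-1)) = q%:R * (A * q.+1%:R * m ^+ q).
    case: (q) => [|q']; first by rewrite !mul0r mulr0 mulr0.
    by rewrite exprS /=; ring.
  by rewrite E3; field.
rewrite qs' /s; field; exact: q0'.
Qed.


Lemma continuous_Hfun : continuous H.
Proof.
have c1 (c : R) : continuous (fun _ : R => c) by move=> x; exact: cvg_cst.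
have cid : continuous (fun x : R => x) by move=> x; exact: cvg_id.
have cp : continuous (fun x : R => (1 + x) * ln (1 + x)).
  move=> x; apply: (@continuous_comp _ _ _ (fun y : R => 1 + y) (fun u => u * ln u)).
    exact: (continuousD (c1 1 x) (cid x)).
  exact: continuous_xlnx.
have cm : continuous (fun x : R => (1 - x) * ln (1 - x)).
  move=> x; apply: (@continuous_comp _ _ _ (fun y : R => 1 - y) (fun u => u * ln u)).
    exact: (continuousB (c1 1 x) (cid x)).
  exact: continuous_xlnx.
move=> x.
have cI := continuousM (c1 2^-1 x) (continuousD (cp x) (cm x)).
have cB := continuousM (c1 beta x) (@exprn_continuous R p x).
exact: (continuousB (continuousD cB (continuousM (c1 h x) (cid x))) cI).
Qed.

(** The first derivative vanishes at an interior maximum and the second by hypothesis. The third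
    vanishes because a maximum admits no odd leading term. Integrating the first-order expansion of
    [dH3] three times then gives the factor [1 / 24]. *)
Lemma maximizer_expansion m : -1 < m < 1 -> global_maximizer H m ->
  derive1n 2 H m = 0 -> (3 <= p)%N ->
  [/\ derive1n 4 H m = - 4 / (1 - m ^+ 2) ^+ 3, derive1n 4 H m < 0 &
      monomial_expansion 4 H m (derive1n 4 H m / 24%:R)].
Proof.
move=> m12 [m12' mmax] m2 p3.
have [d d0 Hd] : exists2 d : R, 0 < d & forall x, `|x - m| < d -> -1 < x < 1.
  move/andP: m12 => [m1 m2'].
  exists (Num.min (1 + m) (1 - m)) => [|x]; first by rewrite lt_min; apply/andP; split; lra.
  by rewrite lt_min !ltr_norml => /andP[/andP[a b] /andP[c e]]; apply/andP; split; lra.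
have hmax x : `|x - m| < d -> H x <= H m.
  by move=> /Hd /andP[x1 x2]; apply: mmax; rewrite !ltW.
have dH1m : dH1 m = 0.
  have [_ <-] := is_derive_Hfun m12.
  suff [_ ->] : is_derive m 1 H 0 by [].
  apply: (@derive1_at_max R H (-1) 1 m) => [|x||x]; first by lra.
  - by rewrite in_itv => /is_derive_Hfun[].
  - by rewrite in_itv.
  - by rewrite in_itv /= => /andP[x1 x2]; apply: mmax; rewrite !ltW.
have dH2m : dH2 m = 0 by rewrite -derive1n2_Hfun.
have E1 := monomial_expansion1 (is_derive_dH2 m12).
have dd1 x : `|x - m| < d -> is_derive x 1 H (dH1 x) by move=> /Hd; exact: is_derive_Hfun.
have dd2 x : `|x - m| < d -> is_derive x 1 dH1 (dH2 x) by move=> /Hd; exact: is_derive_dH1.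
have dd3 x : `|x - m| < d -> is_derive x 1 dH2 (dH3 x) by move=> /Hd; exact: is_derive_dH2.
have E3 := monomial_expansionS d0 dd1 dH1m (monomial_expansionS d0 dd2 dH2m E1).
have dH3m : dH3 m = 0.
  have /eqP := monomial_expansion_odd_max d0 (isT : odd 3) hmax E3.
  by rewrite !mulf_eq0 !invr_eq0 !pnatr_eq0 !orbF => /eqP.
have E4 := monomial_expansionS d0 dd1 dH1m (monomial_expansionS d0 dd2 dH2m
  (monomial_expansionS d0 dd3 dH3m (monomial_expansion1 (is_derive_dH3 m12)))).
rewrite derive1n4_Hfun// dH4_critical//; split => //.
  by rewrite pmulr_llt0 ?oppr_lt0// invr_gt0 exprn_gt0//; nra.
move: E4; rewrite dH4_critical//; set c := - 4 / _.
have -> : c / 2 / 3 / 4 = c / 24%:R by field.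
exact.
Qed.

(** Near [m] the quartic expansion gives the bound; away from [m], compactness and uniqueness of the
    maximizer give a positive gap, which dominates a small multiple of the bounded quantity
    [(x - m)^4]. *)
Lemma quartic_upper_bound m : (3 <= p)%N -> -1 < m < 1 -> global_maximizer H m ->
  (forall m', global_maximizer H m' -> m' = m) -> derive1n 2 H m = 0 ->
  exists2 c : R, 0 < c & forall x, -1 <= x <= 1 -> H x <= H m - c * (x - m) ^+ 4.
Proof.
move=> p3 m12 mmax muniq m2.
have [_ h4] := maximizer_expansion m12 mmax m2 p3.
set k := derive1n 4 H m in h4 * => E4.
(* Half the size of the leading coefficient [k / 24]: an error of this size leaves the other half as
   decay. *)
have k0 : 0 < - k / 48 by lra.
have [d d0 Hd] := E4 _ k0.
(* If the maximum over a segment avoiding [m] equalled [H m], it would be attained at a second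
   global maximizer. *)
have gap (a b : R) : a <= b -> -1 <= a -> b <= 1 -> ~~ (a <= m <= b) ->
    exists2 g : R, 0 < g & forall x, a <= x <= b -> H x <= H m - g.
  move=> ab a1 b1 nm.
  have Hab : {within `[a, b], continuous H}.
    by apply: continuous_subspaceT => x; exact: continuous_Hfun.
  have [c cab cmax] := EVT_max ab Hab.
  move: cab; rewrite in_itv/= => cab.
  exists (H m - H c) => [|x xab]; last by rewrite subKr cmax// in_itv.
  rewrite subr_gt0 lt_neqAle (mmax.2 c) ?andbT; last by move: cab; lra.
  apply/eqP => cm; have cmm : c = m.
    apply: muniq; split; first by move: cab; lra.
    by move=> x x12; rewrite cm; exact: mmax.2.
  by move: nm; rewrite -cmm cab.
have [g1 g10 G1] : exists2 g : R, 0 < g & forall x, -1 <= x <= m - d -> H x <= H m - g.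
  have [md|md] := leP (-1) (m - d); first by apply: gap => //; lra.
  by exists 1 => // x; lra.
have [g2 g20 G2] : exists2 g : R, 0 < g & forall x, m + d <= x <= 1 -> H x <= H m - g.
  have [md|md] := leP (m + d) 1; first by apply: gap => //; lra.
  by exists 1 => // x; lra.
(* The divisor [16] comes from [|x - m| <= 2]. *)
exists (Num.min (- k / 48) (Num.min (g1 / 16) (g2 / 16))) => [|x x12].
  by rewrite !lt_min k0 !divr_gt0.
set c := Num.min _ _.
have [c1 c2 c3] : [/\ c <= - k / 48, c <= g1 / 16 & c <= g2 / 16].
  by rewrite /c !ge_min !lexx !orbT.
have x40 : 0 <= (x - m) ^+ 4 by rewrite exprn_even_ge0.
have x416 : (x - m) ^+ 4 <= 16.
  have -> : 16 = 2 ^+ 4 :> R by ring.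
  rewrite -(ger0_norm x40) normrX lerXn2r ?nnegrE//.
  by rewrite ler_norml; move: m12; lra.
have [xd|] := ltP `|x - m| d.
  have := Hd x xd; rewrite -normrX (ger0_norm x40) ler_norml => /andP[_].
  have := ler_wpM2r x40 c1; lra.
rewrite ler_normr => /orP[xd|xd].
  have : H x <= H m - g2 by apply: G2; move: x12; lra.
  have := ler_wpM2r x40 c3; nra.
have : H x <= H m - g1 by apply: G1; move: x12; lra.
have := ler_wpM2r x40 c2; nra.
Qed.

End Hamiltonian.

(** * Local limit of the weights *)

Section lattice.
Variable R : realType.
Implicit Types (m y x e c : R) (N k : nat).

Definition qroot N : R := N%:R `^ (1 / 4).
(** The magnetization when exactly [k] of the [N] spins are [+1]. *)
Definition mag N k : R := 2 * k%:R / N%:R - 1.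
Definition scaled m N k : R := qroot N * (mag N k - m).

Lemma qroot4 N : qroot N ^+ 4 = N%:R.
Proof. by rewrite /qroot -powR_mulrn ?powR_ge0// -powRrM divfK// powRr1. Qed.

Lemma qroot3 N : N%:R `^ (3 / 4) = qroot N ^+ 3.
Proof.
rewrite /qroot -powR_mulrn ?powR_ge0// -powRrM; congr (_ `^ _); by field.
Qed.

Lemma qroot_ge1 N : (0 < N)%N -> 1 <= qroot N.
Proof.
move=> N0; rewrite -(@ler_pXn2r _ 4)// ?nnegrE ?powR_ge0// expr1n qroot4.
by rewrite ler1n.
Qed.

Lemma qroot_gt0 N : (0 < N)%N -> 0 < qroot N.
Proof. by move=> /qroot_ge1; exact: lt_le_trans. Qed.

Lemma near_qroot_gt e : \forall N \near \oo, e < qroot N.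
Proof.
near=> N; have N0 : (0 < N)%N by near: N; exists 1%N.
have [e0|e0] := ltP e 0; first exact: lt_trans (qroot_gt0 N0).
rewrite -(@ltr_pXn2r _ 4)// ?nnegrE ?powR_ge0// qroot4.
near: N; exact: nbhs_infty_gtr.
Unshelve. all: by end_near. Qed.

Lemma cvg_inv_qroot : (qroot N)^-1 @[N --> \oo] --> (0 : R).
Proof.
apply/cvgrPdist_le => /= e e0; near=> N.
have h : e^-1 < qroot N by near: N; exact: near_qroot_gt.
have q0 : 0 < qroot N by apply: lt_trans h; rewrite invr_gt0.
by rewrite sub0r normrN gtr0_norm ?invr_gt0// invf_ple ?posrE// ltW.
Unshelve. all: by end_near. Qed.

Lemma scaledS m N k : (0 < N)%N -> scaled m N k.+1 = scaled m N k + 2 / qroot N ^+ 3.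
Proof.
move=> N0; have q0 := lt0r_neq0 (qroot_gt0 N0).
by rewrite /scaled /mag -(qroot4 N) -(natr1 k); field.
Qed.

Lemma mag_itv N k : (k <= N)%N -> -1 <= mag N k <= 1.
Proof.
move=> kN; have [->|N0] := posnP N; first by rewrite /mag invr0 mulr0 sub0r lexx; lra.
have N0' : 0 < N%:R :> R by rewrite ltr0n.
rewrite /mag; have : 0 <= 2 * k%:R / N%:R :> R by rewrite divr_ge0// mulr_ge0.
have : 2 * k%:R / N%:R <= 2 :> R.
  by rewrite ler_pdivrMr// ler_pM2l// ler_nat.
lra.
Qed.

Lemma le_scaled m N : (0 < N)%N -> {homo scaled m N : i j / (i <= j)%N >-> i <= j}.
Proof.
move=> N0 i j; elim: j => [|j IH]; first by rewrite leqn0 => /eqP ->.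
rewrite leq_eqVlt => /orP[/eqP->//|]; rewrite ltnS => /IH h.
by rewrite scaledS// (le_trans h)// lerDl divr_ge0// exprn_ge0// powR_ge0.
Qed.

End lattice.

Section local_limit.
Variables (R : realType) (H : R -> R) (m : R).
Hypothesis m12 : -1 < m < 1.
Implicit Types (y x e c : R) (N k : nat).
Local Notation r := (@stirling_rem R).

(** The number of [+1] spins whose magnetization is the lattice value just below [m]. *)
Definition lattice_center N : nat := Num.truncn (N%:R * (1 + m) / 2).

(* Up to a factor depending only on [N], this is the Gibbs weight
   ['C(N, k) exp (N (beta x^p + h x))] at [x = mag N k] when [H] is [Hfun p beta h]. *)
Definition rel_weight N k : R :=
  expR (r (lattice_center N) - r k + (r (N - lattice_center N) - r (N - k)) + N%:R * (H (mag R N k) - H m)).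

(** Chosen so that a magnetization within [2 * eta] of [m] leaves at least [eta * N] spins of each
    sign. *)
Let eta : R := Num.min (1 + m) (1 - m) / 4.

Let eta_gt0 : 0 < eta.
Proof. by rewrite divr_gt0// lt_min; move: m12; lra. Qed.

Let etap : 4 * eta <= 1 + m.
Proof. by rewrite /eta mulrC divfK// ge_min lexx. Qed.

Let etam : 4 * eta <= 1 - m.
Proof. by rewrite /eta mulrC divfK// ge_min lexx orbT. Qed.

Let lattice_centerP N : (0 < N)%N ->
  [/\ (lattice_center N <= N)%N, (lattice_center N)%:R <= N%:R * (1 + m) / 2 &
      N%:R * (1 + m) / 2 < (lattice_center N)%:R + 1].
Proof.
move=> N0; have N0' : 0 < N%:R :> R by rewrite ltr0n.
have c0 : 0 <= N%:R * (1 + m) / 2.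
  by rewrite divr_ge0// mulr_ge0//; move: m12; lra.
have /andP[h1 h2] := truncn_itv c0.
rewrite natr1; split => //.
rewrite -(ler_nat R) (le_trans h1)//.
rewrite ler_pdivrMr// ler_pM2l//; move: m12; lra.
Qed.

(** All indices involved are at least [eta * N], up to one unit, so each increment of the remainder
    costs at most [1 / (eta * N)]; the indices differ by at most [N |mag - m| / 2 + 1]. *)
Let rem_near N k : (0 < N)%N -> (k <= N)%N -> `|mag R N k - m| <= 2 * eta ->
  - ((`|mag R N k - m| + 2 / N%:R) / eta) <=
  r (lattice_center N) - r k + (r (N - lattice_center N) - r (N - k)) <=
  (`|mag R N k - m| + 2 / N%:R) / eta.
Proof.
move=> N0 kN xm; have N0' : 0 < N%:R :> R by rewrite ltr0n.
have [cN c1 c2] := lattice_centerP N0.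
have d0 : 0 < eta * N%:R by rewrite mulr_gt0.
have kE : k%:R = N%:R * (1 + mag R N k) / 2.
  by rewrite /mag; field; rewrite gt_eqF.
move: (xm); rewrite ler_norml => /andP[x1 x2].
have half (u v : R) : 2 * eta <= v -> u = N%:R * v / 2 -> eta * N%:R <= u.
  by move=> ev ->; rewrite [leLHS]mulrC -mulrA ler_pM2l//; lra.
have dk : eta * N%:R <= k%:R by apply: half kE; move: x1 etap; lra.
have dk' : eta * N%:R <= (N - k)%:R.
  by apply: (half _ (1 - mag R N k)); [move: x2 etam; lra|rewrite natrB// kE; field].
have dc : eta * N%:R <= (lattice_center N).+1%:R.
  by rewrite -natr1 (le_trans _ (ltW c2))//; apply: half erefl; move: etap eta_gt0; lra.
have dc' : eta * N%:R <= (N - lattice_center N)%:R.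
  rewrite natrB//; apply: (@le_trans _ _ (N%:R * (1 - m) / 2)).
    by apply: half erefl; move: etam eta_gt0; lra.
  have -> : N%:R * (1 - m) / 2 = N%:R - N%:R * (1 + m) / 2 by field.
  by rewrite lerD2l lerN2.
have S (j : nat) : j%:R <= j.+1%:R :> R by rewrite ler_nat.
have B : `|(lattice_center N)%:R - k%:R| <= N%:R * `|mag R N k - m| / 2 + 1.
  have -> : (lattice_center N)%:R - k%:R =
     ((lattice_center N)%:R - N%:R * (1 + m) / 2) - N%:R * (mag R N k - m) / 2.
    by rewrite kE; field.
  rewrite (le_trans (ler_normB _ _))// addrC lerD//.
    by rewrite !normrM normfV (gtr0_norm N0') (@gtr0_norm _ 2).
  by rewrite ler_norml; lra.
have D1 := stirling_rem_dist d0 (le_trans dk (S _)) dc.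
have D2 := stirling_rem_dist d0 (le_trans dk' (S _)) (le_trans dc' (S _)).
have E : (`|mag R N k - m| + 2 / N%:R) / eta =
    (N%:R * `|mag R N k - m| / 2 + 1) / (eta * N%:R) + (N%:R * `|mag R N k - m| / 2 + 1) / (eta * N%:R).
  by field; rewrite !gt_eqF.
have B1 : `|r (lattice_center N) - r k| <= (N%:R * `|mag R N k - m| / 2 + 1) / (eta * N%:R).
  by apply: (le_trans D1); rewrite ler_pM2r ?invr_gt0.
have B2 : `|r (N - lattice_center N) - r (N - k)| <= (N%:R * `|mag R N k - m| / 2 + 1) / (eta * N%:R).
  apply: (le_trans D2); rewrite ler_pM2r ?invr_gt0// !natrB//.
  have -> : N%:R - (lattice_center N)%:R - (N%:R - k%:R) = - ((lattice_center N)%:R - k%:R) :> R by ring.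
  by rewrite normrN.
move: B1 B2; rewrite E !ler_norml; set Q := _ / (eta * _); lra.
Qed.

(** Within [2 * eta] of [m] the remainders are bounded. Farther away they are at most
    [2 K + 2 N / K], and half of the quartic decay, at least [g N] there, absorbs the linear
    part. *)
Lemma rel_weight_bound c : 0 < c ->
  (forall x, -1 <= x <= 1 -> H x <= H m - c * (x - m) ^+ 4) ->
  exists C : R, forall N k, (0 < N)%N -> (k <= N)%N ->
    rel_weight N k <= expR (C - c / 2 * scaled m N k ^+ 4).
Proof.
(* [g * N] is the value of [c / 2 * scaled^4] at distance [2 * eta] from [m], and [K] is taken so
   large that [2 / K <= g]. *)
move=> c0 Hc; pose g := c / 2 * (2 * eta) ^+ 4.
have g0 : 0 < g 
  by apply: mulr_gt0; [apply: divr_gt0|apply: exprn_gt0; apply: mulr_gt0].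
pose K := (Num.truncn (2 / g)).+1.
have K0 : 0 < K%:R :> R by rewrite ltr0n.
have Kg : 2 / K%:R <= g.
  rewrite ler_pdivrMr// mulrC -ler_pdivrMr//.
  by have /andP[_ /ltW] := @truncn_itv _ (2 / g) (divr_ge0 (ler0n _ 2) (ltW g0)).
exists ((2 * eta + 2) / eta + 2 * K%:R) => N k N0 kN.
have N0' : 0 < N%:R :> R by rewrite ltr0n.
rewrite /rel_weight ler_expR.
have HN : N%:R * (H (mag R N k) - H m) <= - c * scaled m N k ^+ 4.
  rewrite /scaled exprMn qroot4 mulrCA ler_pM2l//.
  have := Hc _ (@mag_itv R N k kN); lra.
have s0 : 0 <= scaled m N k ^+ 4 by rewrite exprn_even_ge0.
have cs0 : 0 <= c * scaled m N k ^+ 4 by rewrite mulr_ge0// ltW.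
have [xm|xm] := leP `|mag R N k - m| (2 * eta).
  have /andP[_ +] := rem_near N0 kN xm.
  have : (`|mag R N k - m| + 2 / N%:R) / eta <= (2 * eta + 2) / eta.
    rewrite ler_pM2r ?invr_gt0// lerD// ler_pdivrMr// ler_pMr// ler1n//.
  by move: HN; have := ltW K0; set P := (_ + 2) / eta; lra.
have [cN _ _] := lattice_centerP N0.
have rc : r (lattice_center N) <= r N by exact: stirling_rem_nd.
have rc' : r (N - lattice_center N) <= r N by apply: stirling_rem_nd; rewrite leq_subr.
have rk : 0 <= r k by rewrite -(stirling_rem0 R) stirling_rem_nd.
have rk' : 0 <= r (N - k) by rewrite -(stirling_rem0 R) stirling_rem_nd.
have rN := @stirling_rem_sublinear R K N (ltn0Sn _).
have far : g * N%:R <= c / 2 * scaled m N k ^+ 4.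
  rewrite /scaled exprMn qroot4 /g -mulrA ler_pM2l ?divr_gt0// mulrC ler_pM2l//.
  have -> : (mag R N k - m) ^+ 4 = `|mag R N k - m| ^+ 4.
    by rewrite -normrX ger0_norm// exprn_even_ge0.
  by rewrite lerXn2r ?nnegrE// ltW// mulr_gt0.
have : 2 / K%:R * N%:R <= g * N%:R by rewrite ler_pM2r.
have : 0 <= (2 * eta + 2) / eta.
  by apply: divr_ge0 (ltW eta_gt0); apply: addr_ge0 => //; apply: mulr_ge0 => //; exact: ltW.
have -> : 2 / K%:R * N%:R = 2 * (N%:R / K%:R) :> R by rewrite -mulrA [K%:R^-1 * _]mulrC.
move: rN HN far; set A := N%:R / K%:R; set B := _ / eta; set G := g * _; set S4 := scaled _ _ _ ^+ 4.
lra.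
Qed.

(** Convergence of the scaled values forces [mag - m] to [0], so [rem_near] squeezes the remainders
    to [0], and [N (mag - m)^4] is exactly [scaled^4]. *)
Lemma rel_weight_cvg c (k_ : nat -> nat) y : monomial_expansion 4 H m c ->
  (\forall N \near \oo, (k_ N <= N)%N) -> scaled m N (k_ N) @[N --> \oo] --> y ->
  rel_weight N (k_ N) @[N --> \oo] --> expR (c * y ^+ 4).
Proof.
move=> E kN sy.
have xm0 : mag R N (k_ N) - m @[N --> \oo] --> (0 : R).
  have : (qroot R N)^-1 * scaled m N (k_ N) @[N --> \oo] --> 0 * y.
    by apply: cvgM => //; exact: cvg_inv_qroot.
  rewrite mul0r; apply: cvg_trans; apply: near_eq_cvg; near=> N.
  rewrite /scaled mulrA mulVf ?mul1r// gt_eqF// qroot_gt0//.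
  by near: N; exists 1%N.
have s4 : scaled m N (k_ N) ^+ 4 @[N --> \oo] --> y ^+ 4.
  by apply: (cvg_comp _ (fun u : R => u ^+ 4) sy); exact: exprn_continuous.
have iN : 2 / N%:R @[N --> \oo] --> (0 : R).
  have q4 : (qroot R N)^-1 ^+ 4 @[N --> \oo] --> (0 : R) ^+ 4.
    by apply: (cvg_comp _ (fun u : R => u ^+ 4) (@cvg_inv_qroot R)); exact: exprn_continuous.
  have : 2 * (qroot R N)^-1 ^+ 4 @[N --> \oo] --> 2 * (0 : R) ^+ 4.
    by apply: cvgM => //; exact: cvg_cst.
  rewrite expr0n/= mulr0; apply: cvg_trans; apply: near_eq_cvg; near=> N.
  by rewrite exprVn qroot4.
apply: (cvg_comp _ (@expR R) _ (@continuous_expR R _)).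
rewrite -[c * _]add0r; apply: cvgD.
  have b0 : (`|mag R N (k_ N) - m| + 2 / N%:R) / eta @[N --> \oo] --> (0 : R).
    have -> : (0 : R) = (`|0 : R| + 0) / eta by rewrite normr0 addr0 mul0r.
    apply: cvgM; last exact: cvg_cst.
    by apply: cvgD => //; exact: cvg_norm.
  apply: (@squeeze_cvgr _ _ _ _ (fun N => - ((`|mag R N (k_ N) - m| + 2 / N%:R) / eta))
     (fun N => (`|mag R N (k_ N) - m| + 2 / N%:R) / eta)) => //.
    near=> N; apply: rem_near.
    - by near: N; exists 1%N.
    - by near: N.
    - near: N; have /cvgrPdist_le := xm0 => /(_ (2 * eta)).
      rewrite mulr_gt0// => /(_ isT); apply: filterS => N.
      by rewrite sub0r normrN.
  by rewrite -oppr0; exact: cvgN.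
apply/cvgrPdist_le => /= e e0.
(* With [scaled^4 <= B], an expansion error of [e / 2 / B] times [(mag - m)^4] is at most [e / 2]
   after multiplication by [N]. *)
have [B B0 HB] : exists2 B : R, 0 < B & \forall N \near \oo, scaled m N (k_ N) ^+ 4 <= B.
  exists (y ^+ 4 + 1); first by rewrite ltr_wpDl// exprn_even_ge0.
  have yB : y ^+ 4 < y ^+ 4 + 1 by rewrite ltrDl.
  exact: (@cvgr_le _ _ _ _ _ _ s4 _ yB).
have eB : 0 < e / 2 / B by rewrite !divr_gt0.
have [d d0 Hd] := E _ eB.
have e2 : 0 < e / 2 by rewrite divr_gt0.
have cs4 : c * scaled m N (k_ N) ^+ 4 @[N --> \oo] --> c * y ^+ 4.
  by apply: cvgM => //; exact: cvg_cst.
have /cvgrPdist_le/(_ _ e2) near1 := cs4.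
have /cvgrPdist_lt/(_ _ d0) near2 := xm0.
near=> N.
have N0 : (0 < N)%N by near: N; exists 1%N.
have N0' : 0 < N%:R :> R by rewrite ltr0n.
have sB : scaled m N (k_ N) ^+ 4 <= B by near: N.
have h1 : `|c * y ^+ 4 - c * scaled m N (k_ N) ^+ 4| <= e / 2.
  by near: N.
have xd : `|mag R N (k_ N) - m| < d.
  by rewrite -normrN -sub0r; near: N.
have := Hd _ xd => h2.
have h3 : `|N%:R * (H (mag R N (k_ N)) - H m) - c * scaled m N (k_ N) ^+ 4| <= e / 2.
  rewrite /scaled exprMn qroot4 mulrCA -mulrBr normrM gtr0_norm//.
  apply: (le_trans (ler_wpM2l (ltW N0') h2)).
  rewrite mulrCA -normrX ger0_norm ?exprn_even_ge0//.
  rewrite -(qroot4 R N) -exprMn -/(scaled m N (k_ N)).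
  rewrite (le_trans (ler_wpM2l (ltW eB) sB))// divfK// gt_eqF//.
rewrite -(subrK (c * scaled m N (k_ N) ^+ 4) (c * y ^+ 4)) -addrA.
rewrite (le_trans (ler_normD _ _))// [leRHS](splitr e) lerD//.
by rewrite distrC.
Unshelve. all: by end_near. Qed.

End local_limit.

(** * Riemann sums over the lattice *)

Section riemann_sum.
Variables (R : realType) (m : R).
Hypothesis m12 : -1 < m < 1.
Implicit Types (y x e c : R) (N k : nat).
Local Notation mu := (@lebesgue_measure R).
Local Notation cell N k := `[scaled m N k, scaled m N k.+1[%classic.

Definition step_fun (v : nat -> R) N y : R :=
  \sum_(k < N.+1) v k * \1_(cell N k) y.

Lemma step_funE v N k y : (0 < N)%N -> (k <= N)%N -> cell N k y ->
  step_fun v N y = v k.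
Proof.
move=> N0 kN; rewrite /= in_itv /= => /andP[ky yk].
rewrite /step_fun (bigD1 (Ordinal (kN : (k < N.+1)%N)))//= big1 => [|i /eqP ik].
  by rewrite addr0 indicE mem_set ?mulr1//= in_itv/= ky.
rewrite indicE memNset ?mulr0//= in_itv/= => /andP[iy yi].
case: (ltngtP i k) => [ltik|ltki|eik].
- by have := le_scaled m N0 ltik; rewrite leNgt (le_lt_trans ky yi).
- by have := le_scaled m N0 ltki; rewrite leNgt (le_lt_trans iy yk).
- by apply: ik; exact: val_inj.
Qed.

Lemma step_fun_bound v N y c : 0 <= c -> (0 < N)%N ->
  (forall k, (k <= N)%N -> cell N k y -> `|v k| <= c) -> `|step_fun v N y| <= c.
Proof.
move=> c0 N0 vc; have [[k kN yk]|nk] := pselect (exists2 k, (k <= N)%N & cell N k y).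
  by rewrite (step_funE _ N0 kN yk) vc.
rewrite /step_fun big1 ?normr0// => i _; rewrite indicE memNset ?mulr0// => yi.
by apply: nk; exists i => //; rewrite -ltnS.
Qed.

Lemma integrable_cell (v : R) N k :
  mu.-integrable setT (fun y => (v * \1_(cell N k) y)%:E).
Proof.
have := @integrableZl _ _ R mu setT measurableT v _
  (integrable_indic_itv (scaled m N k) (scaled m N k.+1) true true).
exact.
Qed.

Lemma integral_cell (v : R) N k : (0 < N)%N ->
  (\int[mu]_y (v * \1_(cell N k) y)%:E = (v * (2 / qroot R N ^+ 3))%:E)%E.
Proof.
move=> N0; have d0 : 0 < 2 / qroot R N ^+ 3.
  by rewrite divr_gt0// exprn_gt0// qroot_gt0.
have -> : (\int[mu]_y (v * \1_(cell N k) y)%:E = v%:E * \int[mu]_y (\1_(cell N k) y)%:E)%E.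
  rewrite -integralZl//.
  exact: (integrable_indic_itv (scaled m N k) (scaled m N k.+1) true true).
have mE : mu (cell N k) = (2 / qroot R N ^+ 3)%:E.
  by rewrite lebesgue_measure_itv/= lte_fin scaledS// ltrDl d0 -EFinB addrC addKr.
by rewrite integral_indic// setIT EFinM -mE.
Qed.

Lemma measurable_step_fun v N : measurable_fun setT (step_fun v N).
Proof.
apply: measurable_sum => k; exact: measurable_funM.
Qed.

Lemma integral_step_fun v N : (0 < N)%N ->
  (\int[mu]_y (step_fun v N y)%:E = (\sum_(k < N.+1) v k * (2 / qroot R N ^+ 3))%:E)%E.
Proof.
move=> N0; under eq_integral => y _ do rewrite /step_fun -sumEFin.
rewrite integral_sum//; last by move=> k; exact: integrable_cell.
by rewrite -sumEFin; apply: eq_bigr => k _; rewrite integral_cell.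
Qed.

Lemma step_fun_locate y : exists2 k_ : nat -> nat,
  \forall N \near \oo, (k_ N <= N)%N /\ cell N (k_ N) y &
  scaled m N (k_ N) @[N --> \oo] --> y.
Proof.
(* The real solution [k] of [scaled m N k = y]; it lies between [0] and [N] for large [N] because
   [-1 < m < 1]. *)
pose u N : R := N%:R * (1 + m + y / qroot R N) / 2.
pose k_ N := Num.truncn (u N).
have yq0 : y / qroot R N @[N --> \oo] --> (0 : R).
  rewrite -(mulr0 y); apply: cvgM; first exact: cvg_cst.
  exact: cvg_inv_qroot.
have H : \forall N \near \oo, [/\ (0 < N)%N, (k_ N <= N)%N & cell N (k_ N) y].
  have /cvgrPdist_lt/(_ (1 + m)) near1 := yq0.
  have /cvgrPdist_lt/(_ (1 - m)) near2 := yq0.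
  have p1 : 0 < 1 + m by move: m12; lra.
  have p2 : 0 < 1 - m by move: m12; lra.
  near=> N.
  have N0 : (0 < N)%N by near: N; exists 1%N.
  have N0' : 0 < N%:R :> R by rewrite ltr0n.
  have q0 := @qroot_gt0 R _ N0.
  have h1 : `|0 - y / qroot R N| < 1 + m by near: N; exact: near1.
  have h2 : `|0 - y / qroot R N| < 1 - m by near: N; exact: near2.
  move: h1 h2; rewrite sub0r normrN !ltr_norml => /andP[h1 _] /andP[_ h2].
  have u0 : 0 <= u N by rewrite /u divr_ge0// mulr_ge0//; lra.
  have /andP[k1 k2] := truncn_itv u0.
  have yE : y = qroot R N * (2 * u N / N%:R - 1 - m).
    by rewrite /u; field; rewrite !gt_eqF.
  have uN : u N <= N%:R by rewrite /u ler_pdivrMr// ler_pM2l//; lra.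
  rewrite /k_; move: (u N) k1 k2 yE uN => w k1 k2 yE uN.
  split => //; first by rewrite -(ler_nat R) (le_trans k1).
  rewrite /= in_itv/= /scaled /mag [X in _ <= X]yE [X in X < _]yE.
  rewrite ler_pM2l// ltr_pM2l// !(lerD2r, ltrD2r) -!mulrA ler_pM2l// ltr_pM2l//.
  by rewrite ler_pM2r ?invr_gt0// ltr_pM2r ?invr_gt0// k1.
exists k_; first by apply: filterS H => N [].
have d0 : y - 2 * (qroot R N)^-1 ^+ 3 @[N --> \oo] --> y.
  rewrite -[X in _ --> X](subr0 y); apply: cvgB; first exact: cvg_cst.
  rewrite -(mulr0 2); apply: cvgM; first exact: cvg_cst.
  have -> : (0 : R) = 0 ^+ 3 by rewrite expr0n.
  by apply: (cvg_comp _ (fun u : R => u ^+ 3) (@cvg_inv_qroot R)); exact: exprn_continuous.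
apply: (squeeze_cvgr _ d0 (cvg_cst y)); apply: filterS H => N [N0 kN].
rewrite /= in_itv/= scaledS// exprVn => /andP[-> h]; rewrite andbT.
by move: (ltW h); rewrite lerBlDr.
Unshelve. all: by end_near. Qed.

(** Dominated convergence for the step functions. Pointwise convergence may fail at [s], a null set;
    this admits the indicator of a half-line ending at [s]. *)
Lemma riemann_sum_cvg (v : nat -> nat -> R) (L : R -> R) (s D : R) :
  0 <= D -> measurable_fun setT L ->
  (forall N k, (0 < N)%N -> (k <= N)%N -> `|v N k| <= D * expR (- scaled m N k ^+ 2)) ->
  (forall y (k_ : nat -> nat), y <> s -> (\forall N \near \oo, (k_ N <= N)%N) ->
     scaled m N (k_ N) @[N --> \oo] --> y -> v N (k_ N) @[N --> \oo] --> L y) ->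
  mu.-integrable setT (EFin \o L) /\
  \sum_(k < N.+1) v N k * (2 / qroot R N ^+ 3) @[N --> \oo] --> \int[mu]_y L y.
Proof.
move=> D0 mL vD vL.
(* A cell has length at most [2], so its left end [z] satisfies
   [y^2 <= 2 z^2 + 2 (y - z)^2 <= 2 z^2 + 8], that is [- z^2 <= 4 - y^2 / 2]. The dominating
   function is a multiple of the normal density. *)
pose g y := D * expR 4 * expR (- y ^+ 2 / 2).
have ig : mu.-integrable setT (EFin \o g).
  have p0 : normal_peak 1 != 0 :> R.
    by rewrite invr_eq0 gt_eqF// sqrtr_gt0 expr1n mul1r mulrn_wgt0// pi_gt0.
  have := @integrableZl _ _ R mu setT measurableT (D * expR 4 / normal_peak 1) _ (integrable_normal_pdf 0 1).
  apply: eq_integrable => // y _.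
  rewrite normal_pdfE ?oner_neq0// -EFinM; congr EFin.
  rewrite mulrA divfK// /g; congr (_ * expR _).
  by rewrite subr0 expr1n.
(* The index is shifted by one because the bounds require [0 < N]. *)
pose f_ n y := (step_fun (v n.+1) n.+1 y)%:E.
have bound n y : (`|f_ n y| <= (EFin \o g) y)%E.
  rewrite /f_ abse_EFin lee_fin; apply: step_fun_bound => //.
    by rewrite /g !mulr_ge0// expR_ge0.
  move=> k kn; rewrite /= in_itv /= scaledS// => /andP[ky yk].
  apply: (le_trans (vD n.+1 k _ kn)) => //.
  rewrite /g -mulrA ler_wpM2l// -expRD ler_expR.
  set z := scaled m n.+1 k in ky yk *.
  have q1 : 1 <= qroot R n.+1 by exact: qroot_ge1.
  have : 2 / qroot R n.+1 ^+ 3 <= 2.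
    by rewrite ler_pdivrMr ?exprn_gt0 ?qroot_gt0// ler_peMr// exprn_ege1.
  set dd := _ / _ in yk * => dd2.
  have : `|y - z| <= 2 by rewrite ger0_norm; lra.
  rewrite -ler_sqr ?nnegrE// real_normK ?num_real// => yz.
  have : 0 <= (y - 2 * z) ^+ 2 by rewrite sqr_ge0.
  by move: yz; rewrite !sqrrB; lra.
have mf n : measurable_fun setT (f_ n).
  by apply/measurable_EFinP; exact: measurable_step_fun.
have mL' : measurable_fun setT (EFin \o L) by apply/measurable_EFinP.
have fL : \forall y \ae mu, setT y -> f_ n y @[n --> \oo] --> (EFin \o L) y.
  exists [set s]; split => //; first exact: lebesgue_measure_set1.
  move=> y /= ny; apply: contrapT => ys; apply: ny => _.
  have [k_ kN ky] := step_fun_locate y.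
  apply: cvg_EFin; first exact: nearW.
  rewrite (_ : fine \o _ = fun n => step_fun (v n.+1) n.+1 y)//.
  rewrite (@cvg_shiftS _ (fun n => step_fun (v n) n y)).
  have kN' : \forall N \near \oo, (k_ N <= N)%N by apply: filterS kN => N [].
  have := vL y k_ ys kN' ky.
  apply: cvg_trans; apply: near_eq_cvg; near=> N.
  have [h1 h2] : (k_ N <= N)%N /\ cell N (k_ N) y by near: N.
  rewrite (@step_funE (v N) N (k_ N) y)//.
  by near: N; exists 1%N.
have ae_bound : \forall y \ae mu, forall n, setT y -> (`|f_ n y| <= (EFin \o g) y)%E.
  exact: aeW.
have [iL _ cv] := @dominated_convergence _ _ R mu setT measurableT f_ (EFin \o L) (EFin \o g)
  mf mL' fL ig ae_bound.
split => //.
rewrite -(@cvg_shiftS _ (fun N => \sum_(k < N.+1) v N k * (2 / qroot R N ^+ 3))).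
have finL : (\int[mu]_y (L y)%:E)%E \is a fin_num by exact: integrable_fin_num.
have : (\int[mu]_y f_ n y)%E @[n --> \oo] --> (\int[mu]_y L y)%:E.
  by rewrite /Rintegral fineK.
move=> /fine_cvg; apply: cvg_trans; apply: near_eq_cvg; near=> n.
by rewrite /= /f_ integral_step_fun.
Unshelve. all: by end_near. Qed.

End riemann_sum.

(** * The maximum likelihood estimate *)

Section exponential_tilt.
Variables (R : realType) (I : finType).
Implicit Types (A u : I -> R) (z : R).

(** The derivative in [z] of the partition function [\sum_i A i * expR (z * u i)]. *)
Definition tilt A u z : R := \sum_i A i * (u i * expR (z * u i)).

(** Each [u expR (z u)] is nondecreasing in [z] whatever the sign of [u], and strictly increasing
    when [u] is nonzero. *)
Lemma tilt_lt A u i0 : (forall i, 0 < A i) -> u i0 != 0 ->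
  {homo tilt A u : z1 z2 / z1 < z2}.
Proof.
move=> A0 u0 z1 z2 z12.
have le i : u i * expR (z1 * u i) <= u i * expR (z2 * u i).
  have [ui|ui] := leP 0 (u i).
    by rewrite ler_wpM2l// ler_expR ler_wpM2r// ltW.
  by rewrite ler_nM2l// ler_expR ler_wnM2r// ltW.
rewrite /tilt (bigD1 i0)//= [ltRHS](bigD1 i0)//= ltr_leD//.
  rewrite ltr_pM2l//; have [ui|ui|/eqP] := ltgtP (u i0) 0; last by rewrite (negPf u0).
    by rewrite ltr_nM2l// ltr_expR ltr_nM2r.
  by rewrite ltr_pM2l// ltr_expR ltr_pM2r.
by apply: ler_sum => i _; rewrite ler_pM2l.
Qed.

Lemma tilt_ge0 A u i0 : (forall i, 0 < A i) -> 0 < u i0 ->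
  exists2 z, 0 <= z & 0 <= tilt A u z.
Proof.
move=> A0 u0; pose S := \sum_i A i * u i.
have d0 : 0 < A i0 * u i0 ^+ 2 by rewrite mulr_gt0// exprn_gt0.
(* For [z >= 0] every term is at least its value at [0], and the term at [i0] gains at least
   [z * (A i0 * u i0 ^+ 2)]; this [z] makes the gain equal to [|S|]. *)
pose z := `|S| / (A i0 * u i0 ^+ 2).
have z0 : 0 <= z by rewrite divr_ge0// ltW.
exists z => //.
have le i : u i <= u i * expR (z * u i).
  have [ui|ui] := leP 0 (u i).
    by rewrite ler_peMr// -expR0 ler_expR mulr_ge0.
  rewrite -[leLHS]mulr1 ler_nM2l// -expR0 ler_expR.
  by rewrite mulr_ge0_le0// ltW.
have le0 : u i0 * (1 + z * u i0) <= u i0 * expR (z * u i0).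
  by rewrite ler_pM2l// expR_ge1Dx.
have : S + z * (A i0 * u i0 ^+ 2) <= tilt A u z.
  rewrite /tilt /S (bigD1 i0)//= [leRHS](bigD1 i0)//= addrAC lerD//.
    have -> : A i0 * u i0 + z * (A i0 * u i0 ^+ 2) = A i0 * (u i0 * (1 + z * u i0)) by ring.
    by rewrite ler_pM2l.
  by apply: ler_sum => i _; rewrite ler_pM2l.
apply: le_trans; rewrite /z divfK ?gt_eqF//.
by rewrite addrC -lerBlDr sub0r -normrN ler_norm.
Qed.

Lemma continuous_tilt A u : continuous (tilt A u).
Proof.
suff aux (s : seq I) : continuous (fun z => \sum_(i <- s) A i * (u i * expR (z * u i))) by exact: aux.
elim: s => [|i s IH].
  by under eq_fun do rewrite big_nil; move=> z; exact: cvg_cst.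
under eq_fun do rewrite big_cons.
move=> z; apply: cvgD; last exact: IH.
apply: cvgM; first exact: cvg_cst.
apply: cvgM; first exact: cvg_cst.
apply: (cvg_comp _ (@expR R) _ (@continuous_expR R _)).
by apply: cvgM; [exact: cvg_id|exact: cvg_cst].
Qed.

(** Intermediate value theorem; [tilt_ge0] applied to [- u] provides the point where [tilt] is
    nonpositive. *)
Lemma tilt_root A u i1 i2 : (forall i, 0 < A i) -> u i1 < 0 -> 0 < u i2 ->
  exists z, tilt A u z = 0.
Proof.
move=> A0 u1 u2; have [b b0 tb] := tilt_ge0 A0 u2.
have u1' : 0 < - u i1 by rewrite oppr_gt0.
have [a a0] := @tilt_ge0 A (fun i => - u i) i1 A0 u1'.
have -> : tilt A (fun i => - u i) a = - tilt A u (- a).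
  by rewrite /tilt -sumrN; apply: eq_bigr => i _; rewrite mulrN mulNr mulNr mulrN.
rewrite oppr_ge0 => ta.
have ab : - a <= b by rewrite (le_trans _ b0)// oppr_le0.
have ct : {within `[- a, b], continuous (tilt A u)}.
  by apply: continuous_subspaceT => x; exact: continuous_tilt.
have [|z _ tz] := @IVT R (tilt A u) (- a) b 0 ab ct; last by exists z.
by rewrite ge_min ta le_max tb orbT.
Qed.

End exponential_tilt.

Section mle.
Variables (R : realType) (p : nat) (beta : R).
Implicit Types (N : nat) (h x z : R).

Definition partition_sum N h : R :=
  \sum_(x : {ffun 'I_N -> bool}) expR (N%:R * (beta * Xbar x ^+ p + h * Xbar x)).

Lemma partition_sum_gt0 N h : 0 < partition_sum N h.
Proof.
rewrite /partition_sum (bigD1 [ffun=> true])//= ltr_pwDl ?expR_gt0//; apply: sumr_ge0 => x _.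
exact: expR_ge0.
Qed.

Lemma PcwE N h (x : {ffun 'I_N -> bool}) :
  Pcw p N beta h x = expR (N%:R * (beta * Xbar x ^+ p + h * Xbar x)) / partition_sum N h.
Proof. by rewrite /Pcw /ZN mulVKf// expf_neq0. Qed.

Lemma Xbar_cst N b : (0 < N)%N -> Xbar ([ffun=> b] : {ffun 'I_N -> bool}) = spin b :> R.
Proof.
move=> N0; rewrite /Xbar; under eq_bigr do rewrite ffunE.
by rewrite sumr_const card_ord -[X in _ * X]mulr_natl mulKf// pnatr_eq0 -lt0n.
Qed.

Let score N x0 := tilt (fun x : {ffun 'I_N -> bool} => expR (N%:R * (beta * Xbar x ^+ p)))
  (fun x : {ffun 'I_N -> bool} => Xbar x - x0).

(** Taking out [expR (N h x0)] centres the exponents at [x0]. The remaining factor is positive, so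
    the likelihood equation has the sign and the zeros of a [tilt]. *)
Let scoreE N x0 h : EXbar p N beta h - x0 =
  score N x0 (N%:R * h) * (expR (N%:R * h * x0) / partition_sum N h).
Proof.
have P0 := lt0r_neq0 (partition_sum_gt0 N h).
rewrite -[X in _ - X](mulfK P0 x0) /EXbar.
under eq_bigr do rewrite PcwE mulrA.
rewrite -mulr_suml -mulrBl mulrA; congr (_ / _).
rewrite /partition_sum mulr_sumr -sumrB /score /tilt mulr_suml; apply: eq_bigr => x _.
rewrite -mulrBl mulrDr expRD.
have -> : N%:R * (h * Xbar x) = N%:R * h * (Xbar x - x0) + N%:R * h * x0 by ring.
by rewrite expRD; ring.
Qed.

(** The estimate [hhat] as a function of the observed magnetization alone. *)
Definition mle N x0 : R := xget 0 [set h' : R | EXbar p N beta h' = x0].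

(** For [x0] strictly between the extreme magnetizations, [Xbar - x0] takes both signs, so the score
    has a zero. Being strictly increasing, it is nonnegative exactly from [mle N x0] on. *)
Lemma mle_le N x0 h : (0 < N)%N -> -1 < x0 < 1 ->
  (mle N x0 <= h) = (x0 <= EXbar p N beta h).
Proof.
move=> N0 /andP[x1 x2]; have N0' : 0 < N%:R :> R by rewrite ltr0n.
have A0 (x : {ffun 'I_N -> bool}) : 0 < expR (N%:R * (beta * Xbar x ^+ p)) by exact: expR_gt0.
have um : Xbar ([ffun=> false] : {ffun 'I_N -> bool}) - x0 < 0 :> R by rewrite Xbar_cst// subr_lt0.
have up : 0 < Xbar ([ffun=> true] : {ffun 'I_N -> bool}) - x0 :> R by rewrite Xbar_cst// subr_gt0.
have c0 h' : 0 < expR (N%:R * h' * x0) / partition_sum N h'.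
  by rewrite divr_gt0 ?expR_gt0// partition_sum_gt0.
have mono h1 h2 : h1 < h2 -> score N x0 (N%:R * h1) < score N x0 (N%:R * h2).
  by move=> h12; apply: (tilt_lt A0 (lt0r_neq0 up)); rewrite ltr_pM2l.
have [z sz] := @tilt_root _ _ _ (fun x : {ffun 'I_N -> bool} => Xbar x - x0) _ _ A0 um up.
have root : exists h', [set h' : R | EXbar p N beta h' = x0] h'.
  exists (z / N%:R) => /=; apply/eqP; rewrite -subr_eq0 scoreE.
  have -> : N%:R * (z / N%:R) = z by rewrite mulrC divfK// gt_eqF.
  by rewrite /score sz mul0r.
have /= mleE : EXbar p N beta (mle N x0) = x0.
  by case: root => h' hh'; exact: (xgetI _ hh').
have s0 : score N x0 (N%:R * mle N x0) = 0.
  have /eqP := scoreE N x0 (mle N x0).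
  by rewrite mleE subrr eq_sym mulf_eq0 (gt_eqF (c0 _)) orbF => /eqP.
rewrite -subr_ge0 -[RHS]subr_ge0 scoreE pmulr_lge0// subr_ge0.
have [h1|h1|<-] := ltgtP (mle N x0) h.
- by rewrite ltW// -s0 mono.
- by rewrite leNgt -[X in _ < X]s0 mono.
- by rewrite s0 lexx.
Qed.

End mle.

(** * Reduction of sums over configurations to binomial sums *)

Section configurations.
Variable R : realType.

(** A configuration is identified with its set of [+1] spins, and these sets are grouped by
    cardinality. *)
Lemma sum_config N (F : R -> R) : (0 < N)%N ->
  \sum_(x : {ffun 'I_N -> bool}) F (Xbar x) =
  \sum_(k < N.+1) 'C(N, k)%:R * F (2 * k%:R / N%:R - 1).
Proof.
move=> N0; have N0' : N%:R != 0 :> R by rewrite pnatr_eq0 -lt0n.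
rewrite (reindex (fun A : {set 'I_N} => [ffun i => i \in A])) /=; last first.
  exists (fun x : {ffun 'I_N -> bool} => finset x) => [A _|x _].
    by apply/setP => i; rewrite inE ffunE.
  by apply/ffunP => i; rewrite ffunE inE.
have X (A : {set 'I_N}) : Xbar [ffun i => i \in A] = 2 * #|A|%:R / N%:R - 1 :> R.
  rewrite /Xbar; under eq_bigr => i _ do rewrite ffunE.
  have -> : \sum_(i < N) spin (i \in A) = 2 * #|A|%:R - N%:R :> R.
    have -> : \sum_(i < N) spin (i \in A) = \sum_(i < N) (2 * (i \in A)%:R - 1) :> R.
      by apply: eq_bigr => i _; rewrite /spin; case: (i \in A) => /=; ring.
    rewrite sumrB -mulr_sumr sumr_const card_ord; congr (2 * _ - _).
    rewrite -sum1_card natr_sum [RHS]big_mkcond/=.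
    by apply: eq_bigr => i _; case: (i \in A).
  by field.
under eq_bigr do rewrite X.
have cA (A : {set 'I_N}) : (#|A| < N.+1)%N by rewrite ltnS -[X in (_ <= X)%N](card_ord N) max_card.
rewrite (partition_big (fun A : {set 'I_N} => Ordinal (cA A)) predT)//=.
apply: eq_bigr => k _; rewrite -[N in 'C(N, _)]card_ord -card_draws.
rewrite mulr_natl -sumr_const; apply: eq_big => A.
  by rewrite inE -val_eqE.
by move=> /eqP <-.
Qed.

End configurations.

(** * Limit of the Gibbs measure *)

Section gibbs_limit.
Variables (R : realType) (p : nat) (beta h m : R).
Hypotheses (p3 : (3 <= p)%N) (m12 : -1 < m < 1).
Local Notation H := (Hfun p beta h).
Local Notation mu := (@lebesgue_measure R).
Hypotheses (mmax : global_maximizer H m)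
  (muniq : forall m', global_maximizer H m' -> m' = m) (m2 : derive1n 2 H m = 0).
Implicit Types (N k : nat) (x y t : R).

Local Notation c4 := (derive1n 4 H m / 24%:R).
Local Notation w := (rel_weight H m).

(** With [q = N^(1/4)], [N t / q^3 = t q] and [q * mag = scaled + q m], so the field shift
    contributes [t * scaled] plus a term free of [k]. All such terms go into [K], which cancels in
    expectations. *)
Lemma bin_rel_weight N t : (0 < N)%N -> exists2 K : R, 0 < K & forall k, (k <= N)%N ->
  'C(N, k)%:R * expR (N%:R * (beta * mag R N k ^+ p + (h + t / qroot R N ^+ 3) * mag R N k)) =
  K * (expR (t * scaled m N k) * w N k).
Proof.
move=> N0; have q0 := lt0r_neq0 (@qroot_gt0 R _ N0).
pose cN := lattice_center m N.
exists (2 ^+ N * expR (stirling_rem N - stirling_rem cN - stirling_rem (N - cN)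
   + N%:R * H m + t * qroot R N * m)) => [|k kN].
  by rewrite mulr_gt0 ?exprn_gt0 ?expR_gt0.
rewrite (ln_bin_stirling R N0 kN) -/(mag R N k) /rel_weight -/cN -!mulrA -!expRD.
congr (_ * expR _); rewrite /Hfun /scaled.
have -> : N%:R * (beta * mag R N k ^+ p + (h + t / qroot R N ^+ 3) * mag R N k) =
   N%:R * (beta * mag R N k ^+ p + h * mag R N k) + t * qroot R N * mag R N k.
  by rewrite -(qroot4 R N); field.
ring.
Qed.

(** The mesh factor cancels in ratios; it makes this a Riemann sum. *)
Definition weight_sum N (v : R -> R) : R :=
  \sum_(k < N.+1) v (scaled m N k) * w N k * (2 / qroot R N ^+ 3).

Lemma weight_sum_gt0 N v : (0 < N)%N -> (forall y, 0 < v y) -> 0 < weight_sum N v.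
Proof.
move=> N0 v0; rewrite /weight_sum big_ord_recl ltr_pwDl//.
  by rewrite !mulr_gt0 ?expR_gt0 ?invr_gt0 ?exprn_gt0 ?qroot_gt0.
apply: sumr_ge0 => k _; apply: mulr_ge0; last by rewrite divr_ge0 ?exprn_ge0 ?powR_ge0.
by rewrite mulr_ge0 ?expR_ge0 ?ltW.
Qed.

Lemma expectation_weight N t (phi : R -> R) : (0 < N)%N ->
  \sum_(x : {ffun 'I_N -> bool}) phi (Xbar x) * Pcw p N beta (h + t / qroot R N ^+ 3) x =
  weight_sum N (fun y => phi (m + y / qroot R N) * expR (t * y)) /
  weight_sum N (fun y => expR (t * y)).
Proof.
move=> N0; have q0 := lt0r_neq0 (@qroot_gt0 R _ N0).
have [K K0 HK] := bin_rel_weight t N0.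
set h' := h + _ in HK *.
have S (psi : R -> R) : \sum_(x : {ffun 'I_N -> bool})
      psi (Xbar x) * expR (N%:R * (beta * Xbar x ^+ p + h' * Xbar x)) =
    K * (qroot R N ^+ 3 / 2) * weight_sum N (fun y => psi (m + y / qroot R N) * expR (t * y)).
  rewrite (@sum_config R N (fun u => psi u * expR (N%:R * (beta * u ^+ p + h' * u))))//.
  rewrite /weight_sum mulr_sumr; apply: eq_bigr => k _.
  have kN : (k <= N)%N by rewrite -ltnS.
  rewrite mulrCA -/(mag R N k) HK//.
  have -> : m + scaled m N k / qroot R N = mag R N k.
    by rewrite /scaled mulrAC divff// mul1r addrC subrK.
  by field.
under eq_bigr do rewrite PcwE mulrA.
rewrite -mulr_suml S.
have -> : partition_sum p beta N h' = K * (qroot R N ^+ 3 / 2) * weight_sum N (fun y => expR (t * y)).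
  have := S (fun=> 1); rewrite /partition_sum; under eq_bigr do rewrite mul1r.
  move=> ->; congr (_ * _); rewrite /weight_sum.
  by apply: eq_bigr => k _; rewrite mul1r.
have D0 : weight_sum N (fun y => expR (t * y)) != 0.
  by rewrite gt_eqF// weight_sum_gt0// => y; exact: expR_gt0.
by field; rewrite D0 q0 gt_eqF.
Qed.

Lemma weight_sum_cvg (g_ : nat -> R -> R) (g : R -> R) (s B : R) :
  measurable_fun setT g -> 0 <= B ->
  (forall N y, `|g_ N y| <= expR (B * `|y|)) ->
  (forall y (z_ : nat -> R), y <> s -> z_ N @[N --> \oo] --> y ->
     g_ N (z_ N) @[N --> \oo] --> g y) ->
  mu.-integrable setT (fun y => (g y * expR (c4 * y ^+ 4))%:E) /\
  weight_sum N (g_ N) @[N --> \oo] --> \int[mu]_y (g y * expR (c4 * y ^+ 4)).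
Proof.
move=> mg B0 gB gcvg.
have [_ _ E4] := maximizer_expansion m12 mmax m2 p3.
have [c c0 Hc] := quartic_upper_bound p3 m12 mmax muniq m2.
have [C HC] := rel_weight_bound m12 c0 Hc.
pose q := c / 2; have q0 : 0 < q by rewrite divr_gt0.
(* The constant comes from [B |y| <= B^2 + y^2] and [2 y^2 <= q y^4 + 1 / q], which together turn
   [B |y| - q y^4] into at most [B^2 + 1 / q - y^2]. *)
apply: (@riemann_sum_cvg R m m12 (fun N k => g_ N (scaled m N k) * w N k)
  (fun y => g y * expR (c4 * y ^+ 4)) s (expR (C + B ^+ 2 + q^-1))).
- exact: expR_ge0.
- apply: measurable_funM => //; apply: measurableT_comp => //.
  by apply: measurable_funM => //; exact: measurable_funX.
- move=> N k N0 kN; rewrite normrM [X in _ * X]ger0_norm ?expR_ge0//.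
  apply: (le_trans (ler_pM _ _ (gB N _) (HC N k N0 kN))) => //; first exact: expR_ge0.
  rewrite -!expRD ler_expR -/q; set y := scaled m N k.
  have h1 : B * `|y| <= B ^+ 2 + y ^+ 2.
    rewrite -[y ^+ 2]ger0_norm ?sqr_ge0// normrX.
    have := sqr_ge0 (B - `|y|); have := sqr_ge0 (B + `|y|).
    by rewrite sqrrB sqrrD; have := normr_ge0 y; nra.
  have h2 : 2 * y ^+ 2 <= q * y ^+ 4 + q^-1.
    have : 0 <= q^-1 * (q * y ^+ 2 - 1) ^+ 2 by rewrite mulr_ge0 ?sqr_ge0 ?invr_ge0 ?ltW.
    have -> : q^-1 * (q * y ^+ 2 - 1) ^+ 2 = q * y ^+ 4 + q^-1 - 2 * y ^+ 2.
      by field; rewrite gt_eqF.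
    by rewrite subr_ge0.
  lra.
- move=> y k_ ys kN ky; apply: cvgM; first exact: gcvg ky.
  exact: rel_weight_cvg kN ky.
Qed.

(** On [[0, 1]] the integrand is at least [expR (- |t| - |c4|)]. This allows division by the limit
    of the normalizing sums. *)
Lemma integral_gt0 t : mu.-integrable setT (fun y => (expR (t * y) * expR (c4 * y ^+ 4))%:E) ->
  0 < \int[mu]_y (expR (t * y) * expR (c4 * y ^+ 4)).
Proof.
move=> ig; pose f y := expR (t * y) * expR (c4 * y ^+ 4).
have f0 y : 0 <= f y by rewrite mulr_ge0 ?expR_ge0.
pose b := expR (- `|t| - `|c4|).
have mf : measurable_fun setT (EFin \o f) by exact: measurable_int ig.
have I01 : (b%:E <= \int[mu]_(y in `[0%R, 1%R]) (f y)%:E)%E.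
  have <- : (\int[mu]_(y in `[0%R, 1%R]) b%:E = b%:E)%E.
    have m01 : mu `[0, 1]%classic = 1%E.
      by rewrite lebesgue_measure_itv/= lte_fin ltr01 -EFinB subr0.
    by rewrite integral_cst//= -[RHS]mule1 -m01.
  apply: ge0_le_integral => //.
  - by move=> y _; rewrite lee_fin expR_ge0.
  - exact: measurable_funS mf.
  move=> y; rewrite /= in_itv/= => /andP[y0 y1]; rewrite lee_fin /f -expRD ler_expR lerD//.
    rewrite lerNl -mulNr (le_trans (ler_norm _))// normrM normrN ger0_norm//.
    by rewrite ler_piMr.
  rewrite lerNl -mulNr (le_trans (ler_norm _))// normrM normrN [X in _ * X]ger0_norm ?exprn_ge0//.
  by rewrite ler_piMr// exprn_ile1.
have IT : (b%:E <= \int[mu]_y (f y)%:E)%E.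
  apply: (le_trans I01); apply: ge0_subset_integral => //.
  by move=> y _; rewrite lee_fin.
have fin : (\int[mu]_y (f y)%:E)%E \is a fin_num by exact: integrable_fin_num.
apply: (lt_le_trans (expR_gt0 (- `|t| - `|c4|))).
by rewrite -lee_fin /Rintegral fineK.
Qed.


(** Serves twice: with the identity as test function for the tilted mean, and at [t = 0] with the
    indicator of the event for the distribution function. *)
Lemma ratio_cvg t (g_ : nat -> R -> R) (g : R -> R) (s B : R) :
  measurable_fun setT g -> 0 <= B ->
  (forall N y, `|g_ N y| <= expR (B * `|y|)) ->
  (forall y (z_ : nat -> R), y <> s -> z_ N @[N --> \oo] --> y ->
     g_ N (z_ N) @[N --> \oo] --> g y) ->
  weight_sum N (fun y => g_ N y * expR (t * y)) / weight_sum N (fun y => expR (t * y))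
    @[N --> \oo] -->
  (\int[mu]_y (g y * expR (phiF p beta h m 0 t y))) / (\int[mu]_y expR (phiF p beta h m 0 t y)).
Proof.
move=> mg B0 gB gcvg.
have phiE y : expR (phiF p beta h m 0 t y) = expR (t * y) * expR (c4 * y ^+ 4).
  by rewrite /phiF -expRD !mul0r add0r addrC.
have me : measurable_fun setT (fun y : R => expR (t * y)).
  by apply: measurableT_comp => //; exact: measurable_funM.
have eb y : expR (t * y) <= expR (`|t| * `|y|).
  by rewrite ler_expR -normrM ler_norm.
have ecvg y (z_ : nat -> R) : z_ N @[N --> \oo] --> y -> expR (t * z_ N) @[N --> \oo] --> expR (t * y).
  move=> zy; apply: (cvg_comp _ (@expR R) _ (@continuous_expR R _)).
  by apply: cvgM => //; exact: cvg_cst.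
have [|y z_ _ /ecvg//|i1 c1] :=
  @weight_sum_cvg (fun _ y => expR (t * y)) (fun y => expR (t * y)) s `|t| me (normr_ge0 _).
  by move=> _ y; rewrite ger0_norm ?expR_ge0.
have mge : measurable_fun setT (fun y : R => g y * expR (t * y)) by exact: measurable_funM.
have [||N y|y z_ ys zy|i2 c2] :=
  @weight_sum_cvg (fun N y => g_ N y * expR (t * y)) (fun y => g y * expR (t * y)) s (B + `|t|).
- exact: mge.
- by rewrite addr_ge0.
- rewrite normrM [X in _ * X]ger0_norm ?expR_ge0// mulrDl expRD.
  by apply: ler_pM.
- by apply: cvgM; [exact: gcvg ys zy|exact: ecvg].
have -> : \int[mu]_y (g y * expR (phiF p beta h m 0 t y)) =
    \int[mu]_y (g y * expR (t * y) * expR (c4 * y ^+ 4)).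
  by apply: eq_Rintegral => y _; rewrite phiE mulrA.
have -> : \int[mu]_y expR (phiF p beta h m 0 t y) =
    \int[mu]_y (expR (t * y) * expR (c4 * y ^+ 4)).
  by apply: eq_Rintegral => y _; rewrite phiE.
apply: cvgM => //; apply: cvgV => //.
by rewrite gt_eqF// integral_gt0.
Qed.

End gibbs_limit.

(** * Convergence in distribution of the rescaled estimate *)

Theorem mainTheorem4 (R : realType) (p : nat) (beta h : R) :
  (3 <= p)%N -> 0 <= beta -> pspecial p beta h ->
  forall mstar : R, global_maximizer (Hfun p beta h) mstar ->
  forall t : R, {for t, continuous (G1 p beta h mstar)} ->
  (fun N : nat =>
     ProbCW p N beta h
       (fun x => (N%:R `^ (3 / 4 : R)) * (hhat p N beta x - h) <= t))
    @ \oo --> G1 p beta h mstar t.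
Proof.
move=> p3 _ [m [m12 mmax muniq m2]] mstar /muniq -> t _ {mstar}.
pose mean N := EXbar p N beta (h + t / qroot R N ^+ 3).
(* The left side is the mean of [y = N^(1/4) (Xbar - m)] under the shifted field; [|y| <= expR |y|]
   gives the growth constant [1]. *)
have mean_cvg : qroot R N * (mean N - m) @[N --> \oo] --> meanF p beta h m 0 t.
  have := @ratio_cvg R p beta h m p3 m12 mmax muniq m2 t
    (fun _ y => y) id 0 1 (@measurable_id _ _ setT) ler01.
  have yb (N : nat) (y : R) : `|y| <= expR (1 * `|y|).
    rewrite mul1r (le_trans _ (expR_ge1Dx _))// lerDr//.
  move=> /(_ yb (fun _ _ _ z => z)).
  apply: cvg_trans; apply: near_eq_cvg; near=> N.
  have N0 : (0 < N)%N by near: N; exists 1%N.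
  have q0 := lt0r_neq0 (@qroot_gt0 R _ N0).
  have := @expectation_weight R p beta h m N t id N0.
  rewrite -/(EXbar _ _ _ _) -/(mean N) => ->.
  have D0 : weight_sum p beta h m N (fun y => expR (t * y)) != 0.
    by rewrite gt_eqF// weight_sum_gt0// => y; exact: expR_gt0.
  apply: (mulIf D0); rewrite -[RHS]mulrA mulrBl divfK// divfK//.
  rewrite /weight_sum mulr_sumr -sumrB mulr_sumr; apply: eq_bigr => k _.
  by field.
set s := meanF p beta h m 0 t in mean_cvg *.
pose ind (b : bool) : R := b%:R.
(* The event as a function of the rescaled magnetization, and its limit, which jumps only at the
   exempted point [s]. *)
pose g_ N y := ind (qroot R N ^+ 3 * (mle p beta N (m + y / qroot R N) - h) <= t).
pose g y := ind (y <= s).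
have mg : measurable_fun setT g.
  rewrite (_ : g = \1_(`]-oo, s]%classic)); first exact: measurable_indic.
  apply/funext => y; rewrite indicE /g /ind; congr (_%:R).
  by rewrite mem_setE in_itv.
have gcvg y (z_ : nat -> R) : y <> s -> z_ N @[N --> \oo] --> y -> g_ N (z_ N) @[N --> \oo] --> g y.
  move=> /eqP ys zy.
  have xm : m + z_ N / qroot R N @[N --> \oo] --> m.
    rewrite -[X in _ --> X]addr0 -[X in _ + X](mulr0 y).
    apply: cvgD; first exact: cvg_cst.
    by apply: cvgM => //; exact: cvg_inv_qroot.
  have /andP[mm1 mm2] := m12.
  have near1 := @cvgr_gt _ _ _ _ _ _ xm _ mm1.
  have near2 := @cvgr_lt _ _ _ _ _ _ xm _ mm2.
  have ds : qroot R N * (mean N - m) - z_ N @[N --> \oo] --> s - y by exact: cvgB.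
  (* Near [m] the magnetization stays away from [-1] and [1], hence from the default value of
     [xget], and [mle_le] applies. *)
  have key : \forall N \near \oo, g_ N (z_ N) = ind (0 <= qroot R N * (mean N - m) - z_ N).
    near=> N.
    have N0 : (0 < N)%N by near: N; exists 1%N.
    have q0 := @qroot_gt0 R _ N0.
    have x12 : -1 < m + z_ N / qroot R N < 1.
      by apply/andP; split; near: N; [exact: near1|exact: near2].
    rewrite /g_; congr ind.
    rewrite mulrC -ler_pdivlMr ?exprn_gt0// lerBlDl mle_le// -/(mean N).
    by rewrite subr_ge0 -lerBrDl ler_pdivrMr// mulrC.
  have [ys'|ys'|ys'] := ltgtP y s; last by rewrite ys' eqxx in ys.
  - have sy0 : 0 < s - y by rewrite subr_gt0.
    have near3 := @cvgr_gt _ _ _ _ _ _ ds _ sy0.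
    have -> : g y = 1 by rewrite /g (ltW ys').
    apply: cvg_near_cst; near=> N.
    have -> : g_ N (z_ N) = ind (0 <= qroot R N * (mean N - m) - z_ N) by near: N.
    have h3 : 0 < qroot R N * (mean N - m) - z_ N by near: N; exact: near3.
    by rewrite (ltW h3).
  - have sy0 : s - y < 0 by rewrite subr_lt0.
    have near3 := @cvgr_lt _ _ _ _ _ _ ds _ sy0.
    have -> : g y = 0 by rewrite /g leNgt ys'.
    apply: cvg_near_cst; near=> N.
    have -> : g_ N (z_ N) = ind (0 <= qroot R N * (mean N - m) - z_ N) by near: N.
    have h3 : qroot R N * (mean N - m) - z_ N < 0 by near: N; exact: near3.
    by rewrite leNgt h3.
have gb (N : nat) (y : R) : `|g_ N y| <= expR (0 * `|y|).
  by rewrite mul0r expR0 /g_ /ind normr_nat lern1 leq_b1.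
(* No tilt here: the law of [Xbar] is taken at the true field [h], and [t] enters only through
   [s]. *)
have := @ratio_cvg R p beta h m p3 m12 mmax muniq m2 0 g_ g s 0 mg (lexx 0) gb gcvg.
have -> : \int[lebesgue_measure]_y (g y * expR (phiF p beta h m 0 0 y)) =
    Rintegral lebesgue_measure `]-oo, s] (fun y => expR (phiF p beta h m 0 0 y)).
  rewrite [RHS]Rintegral_mkcond; apply: eq_Rintegral => y _.
  by rewrite patchE /g /ind mem_setE in_itv/=; case: (y <= s); rewrite ?mul1r ?mul0r.
apply: cvg_trans; apply: near_eq_cvg; near=> N.
have N0 : (0 < N)%N by near: N; exists 1%N.
have := @expectation_weight R p beta h m N 0
  (fun x => ind (qroot R N ^+ 3 * (mle p beta N x - h) <= t)) N0.
rewrite mul0r addr0 => <-.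
rewrite /ProbCW [RHS]big_mkcond/=; apply: eq_bigr => x _.
by rewrite qroot3 /hhat -/(mle _ _ _ _) /ind; case: (_ <= t); rewrite ?mul1r ?mul0r.
Unshelve. all: by end_near. Qed.
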